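(* The algebra $K[X]$ is a polynomial algebra; its set of variables is the set of all unaugmented connected invariants. The algebra $K[X]_{aug}$ is isomorphic to $K[X]\otimes K[D]$, where $D$ is the dimension invariant (and $K[D]$ is a polynomial algebra in one variable).
   Context: $K$ is an algebraically closed field of characteristic zero and a type $((p_1,q_1),\ldots,(p_r,q_r))\in(\mathbb{N}^2)^r$ is fixed. An algebraic structure of this type is a finite dimensional $K$-vector space $W$ with tensors $x_i\in W^{p_i,q_i}=W^{\otimes p_i}\otimes(W^* )^{\otimes q_i}\cong\mathrm{Hom}_K(W^{\otimes q_i},W^{\otimes p_i})$. A closed diagram is a finite list of boxes labelled by elements of $\{x_1,\ldots,x_r,\mathrm{Id}_W\}$, where a box $x_i$ has $q_i$ ordered input strings and $p_i$ ordered output strings and a box $\mathrm{Id}_W$ has one input and one output string, together with a bijection (connection) from the set of all output strings to the set of all input strings. For an algebraic structure $(W,(x_i))$ it represents a scalar: tensor the maps labelling the boxes ($\mathrm{Id}_W$ being the identity of $W$) and apply $W\otimes W^*\to K$ to each connected output/input pair. Two closed diagrams are equivalent if they represent the same scalar for every algebraic structure. This equivalence relation is generated by (i) permuting the boxes (carrying along strings and connections), and (ii) identity reduction: deleting a box $\mathrm{Id}_W$ whose output string is not connected to its own input string, and connecting directly the output string that was connected to its input with the input string that was connected to its output. $K[X]_{aug}$ is the free $K$-vector space on equivalence classes of closed diagrams (called invariants), with product given by juxtaposition and unit the empty diagram. An invariant is connected if it is nonempty and its diagram is connected; it is unaugmented if it is equal to one given by a diagram without $\mathrm{Id}_W$ boxes,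 and augmented otherwise. $K[X]\subseteq K[X]_{aug}$ is the subalgebra spanned by the unaugmented invariants. The dimension invariant $D$ is the diagram consisting of one $\mathrm{Id}_W$ box whose output is connected to its own input; it represents $\mathrm{Tr}(\mathrm{Id}_W)=\dim W$. *)

(* Defs.v *)
From HB Require Import structures.
From mathcomp Require Import all_boot all_order all_algebra.
From mathcomp Require Import boolp.
From mathcomp.multinomials Require Export monalg.

Set Implicit Arguments.
Unset Strict Implicit.
Unset Printing Implicit Defensive.

Import GRing.Theory.
Local Open Scope ring_scope.
Local Open Scope quotient_scope.

(** * Tensors and algebraic structures *)

Section Tensors.
Variable K : fieldType.

(* [W^{p,q}] for a finite dimensional [W], as the space of multilinear forms on
   [(W^* )^p x W^q]: the element [w_1 (x) .. (x) w_p (x) f_1 (x) .. (x) f_q] is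
   the form [(xi, v) |-> \prod_i xi_i(w_i) * \prod_j f_j(v_j)]. *)

Definition subst_at (V : Type) (n : nat) (u : {ffun 'I_n -> V}) (i : 'I_n)
  (a : V) : {ffun 'I_n -> V} := [ffun j => if j == i then a else u j].

Definition multilinear (W : vectType K) (p q : nat)
    (t : {ffun 'I_p -> 'Hom(W, K^o)} -> {ffun 'I_q -> W} -> K) : Prop :=
  (forall v xi i, linear (fun a => t (subst_at xi i a) v : K^o)) /\
  (forall xi v i, linear (fun a => t xi (subst_at v i a) : K^o)).

Record tensor (W : vectType K) (p q : nat) := Tensor {
  tensor_fun :> {ffun 'I_p -> 'Hom(W, K^o)} -> {ffun 'I_q -> W} -> K;
  tensor_multilinear : multilinear tensor_fun }.

Definition id_form (W : vectType K) (xi : {ffun 'I_1 -> 'Hom(W, K^o)})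
  (v : {ffun 'I_1 -> W}) : K := xi ord0 (v ord0).

Lemma id_form_multilinear (W : vectType K) : multilinear (@id_form W).
Proof.
split=> [v xi i|xi v i] c a b; rewrite /id_form /subst_at !ffunE (ord1 i) eqxx.
  by rewrite add_lfunE scale_lfunE.
by rewrite linearP.
Qed.

Definition id_tensor (W : vectType K) : tensor W 1 1 :=
  Tensor (@id_form_multilinear W).

Definition zero_form (W : vectType K) (p q : nat)
  (_ : {ffun 'I_p -> 'Hom(W, K^o)}) (_ : {ffun 'I_q -> W}) : K := 0.

Lemma zero_form_multilinear (W : vectType K) p q :
  multilinear (@zero_form W p q).
Proof. by split=> [v xi i|xi v i] c a b; rewrite /zero_form scaler0 addr0. Qed.

Record algebraic_structure (r : nat) (ty : 'I_r -> nat * nat) :=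
  AlgebraicStructure {
    carrier : vectType K;
    structure_tensor : forall i : 'I_r, tensor carrier (ty i).1 (ty i).2 }.

End Tensors.

(** * Closed diagrams *)

Section Diagrams.
Variables (r : nat) (ty : 'I_r -> nat * nat).

(* [Some i] stands for the label [x_i] and [None] for [Id_W]. *)
Definition box_label : Type := option 'I_r.

Definition out_arity (l : box_label) : nat := if l is Some i then (ty i).1 else 1.
Definition in_arity (l : box_label) : nat := if l is Some i then (ty i).2 else 1.

Definition strings (arity : box_label -> nat) (n : nat)
  (lab : 'I_n -> box_label) : finType := {b : 'I_n & 'I_(arity (lab b))}.

Record diagram := Diagram {
  nboxes : nat;
  label : 'I_nboxes -> box_label;
  connection : strings out_arity label -> strings in_arity label;
  connection_bij : bijective connection }.

Arguments label : clear implicits.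

Definition loops_label (n : nat) (_ : 'I_n) : box_label := None.
Definition loops_connection (n : nat)
  (s : strings out_arity (@loops_label n)) : strings in_arity (@loops_label n) := s.

Lemma loops_connection_bij n : bijective (@loops_connection n).
Proof. by exists id. Qed.

(* [n] boxes [Id_W], each with its output connected to its own input. *)
Definition loops (n : nat) : diagram := Diagram (@loops_connection_bij n).

Definition empty_diagram : diagram := loops 0.
Definition loop_diagram : diagram := loops 1.

(** ** Juxtaposition *)

Lemma eq_tagged_ord (T : Type) (a : T -> nat) (x y : {t : T & 'I_(a t)}) :
  tag x = tag y -> tagged x = tagged y :> nat -> x = y.
Proof.
by case: x y => [t i] [u j] /= e; case: _ / e j => j /val_inj ->.
Qed.

Section Juxtapose.
Variables (m n : nat) (lab1 : 'I_m -> box_label) (lab2 : 'I_n -> box_label).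

Definition sum_label (b : 'I_m + 'I_n) : box_label :=
  match b with inl b1 => lab1 b1 | inr b2 => lab2 b2 end.

Definition juxt_label (b : 'I_(m + n)) : box_label := sum_label (split b).

Variable arity : box_label -> nat.

Definition sum_string (s : strings arity lab1 + strings arity lab2) :
    {b : 'I_m + 'I_n & 'I_(arity (sum_label b))} :=
  match s with
  | inl s1 => existT (fun b => 'I_(arity (sum_label b))) (inl (tag s1)) (tagged s1)
  | inr s2 => existT (fun b => 'I_(arity (sum_label b))) (inr (tag s2)) (tagged s2)
  end.

Definition string_sum (s : {b : 'I_m + 'I_n & 'I_(arity (sum_label b))}) :
    strings arity lab1 + strings arity lab2 :=
  match s with
  | existT (inl b) j => inl (existT (fun b => 'I_(arity (lab1 b))) b j)
  | existT (inr b) j => inr (existT (fun b => 'I_(arity (lab2 b))) b j)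
  end.

Lemma sum_stringK : cancel sum_string string_sum.
Proof. by case=> -[]. Qed.

Lemma string_sumK : cancel string_sum sum_string.
Proof. by case=> -[b|b] j. Qed.

Definition join_string (s : strings arity lab1 + strings arity lab2) :
    strings arity juxt_label :=
  let s' := sum_string s in
  existT (fun b => 'I_(arity (juxt_label b))) (unsplit (tag s'))
    (cast_ord (congr1 (fun b => arity (sum_label b)) (esym (unsplitK (tag s'))))
              (tagged s')).

Definition split_string (s : strings arity juxt_label) :
    strings arity lab1 + strings arity lab2 :=
  string_sum (existT (fun b => 'I_(arity (sum_label b))) (split (tag s)) (tagged s)).

Lemma join_stringK : cancel join_string split_string.
Proof.
move=> s; rewrite -[RHS]sum_stringK /split_string; apply: f_equal.
by apply: eq_tagged_ord => //=; apply: unsplitK.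
Qed.

Lemma split_stringK : cancel split_string join_string.
Proof.
move=> s; rewrite /join_string; apply: eq_tagged_ord => /=.
  by rewrite string_sumK splitK.
by rewrite string_sumK.
Qed.

End Juxtapose.

Definition juxt_connection (d1 d2 : diagram)
    (s : strings out_arity (juxt_label (label d1) (label d2))) :
    strings in_arity (juxt_label (label d1) (label d2)) :=
  join_string match split_string s with
              | inl s1 => inl (connection s1)
              | inr s2 => inr (connection s2)
              end.

Lemma juxt_connection_bij d1 d2 : bijective (@juxt_connection d1 d2).
Proof.
have [g1 g1K Kg1] := connection_bij d1; have [g2 g2K Kg2] := connection_bij d2.
exists (fun s => join_string match split_string s with
              | inl s1 => inl (g1 s1) | inr s2 => inr (g2 s2) end) => s.
  rewrite /juxt_connection join_stringK -[RHS]split_stringK.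
  by case: (split_string s) => t; rewrite ?g1K ?g2K.
rewrite /juxt_connection join_stringK -[RHS]split_stringK.
by case: (split_string s) => t; rewrite ?Kg1 ?Kg2.
Qed.

Definition juxtapose (d1 d2 : diagram) : diagram :=
  Diagram (@juxt_connection_bij d1 d2).

(** ** Connected diagrams *)

Definition adjacent (d : diagram) (b b' : 'I_(nboxes d)) : bool :=
  [exists s : strings out_arity (label d),
     (tag s == b) && (tag (connection s) == b')].

Definition connected_diagram (d : diagram) : bool :=
  (0 < nboxes d)%N &&
  [forall b, forall b',
     connect (fun c c' : 'I_(nboxes d) => adjacent c c' || adjacent c' c) b b'].

Definition id_free (d : diagram) : bool := [forall b, label d b != None].

End Diagrams.

Arguments label {r ty} d _.

(** * The scalar represented by a closed diagram *)

Section Value.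
Variables (K : fieldType) (r : nat) (ty : 'I_r -> nat * nat).

Definition box_tensor (A : algebraic_structure K ty) (l : box_label r) :
    tensor (carrier A) (out_arity ty l) (in_arity ty l) :=
  match l with
  | Some i => structure_tensor A i
  | None => id_tensor (carrier A)
  end.

Definition basis_vec (W : vectType K) (j : 'I_(\dim {:W})) : W :=
  (vbasis {:W})`_j.

Definition basis_covec (W : vectType K) (j : 'I_(\dim {:W})) : 'Hom(W, K^o) :=
  linfun (coord (vbasis {:W}) j : W -> K^o).

(* Applying [W (x) W^* -> K] to an output/input pair of a multilinear form [T]
   gives [\sum_j T(.. e_j^* .., .. e_j ..)] for any basis [e] of [W] and its dual
   basis [e^*].  All the pairs are contracted at once, by summing over the
   functions [f] assigning an index [j] to each pair; the pairs are named after
   their input string. *)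
Definition value (A : algebraic_structure K ty) (d : diagram ty) : K :=
  \sum_(f : {ffun strings (in_arity ty) (label d) -> 'I_(\dim {:carrier A})})
    \prod_(b < nboxes d)
      box_tensor A (label d b)
        [ffun j => basis_covec (f (connection
            (existT (fun b => 'I_(out_arity ty (label d b))) b j)))]
        [ffun j => basis_vec (f
            (existT (fun b => 'I_(in_arity ty (label d b))) b j))].

Definition equivalent (d1 d2 : diagram ty) : Prop :=
  forall A : algebraic_structure K ty, value A d1 = value A d2.

Definition box_term (A : algebraic_structure K ty) (l : box_label r)
    (F : 'I_(out_arity ty l) -> 'I_(\dim {:carrier A}))
    (G : 'I_(in_arity ty l) -> 'I_(\dim {:carrier A})) : K :=
  box_tensor A l [ffun j => basis_covec (F j)] [ffun j => basis_vec (G j)].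

Lemma eq_box_term A l l' (e : l = l')
    (eo : out_arity ty l = out_arity ty l') (ei : in_arity ty l = in_arity ty l')
    F G F' G' :
  (forall j, F j = F' (cast_ord eo j)) -> (forall j, G j = G' (cast_ord ei j)) ->
  @box_term A l F G = @box_term A l' F' G'.
Proof.
case: _ / e eo ei F' G' => eo ei F' G' eF eG; rewrite /box_term.
by congr (box_tensor _ _ _ _); apply/ffunP=> j; rewrite !ffunE ?eF ?eG cast_ord_id.
Qed.

Lemma value_no_box A d : nboxes d = 0%N -> value A d = 1.
Proof.
case: d => n lab con conP /= n0; move: lab con conP; rewrite {}n0 => lab con conP.
rewrite /value /=; under eq_bigr do rewrite big_ord0.
have noS : #|{: strings (in_arity ty) lab}| = 0%N.
  by apply/eqP; rewrite -leqn0 leqNgt; apply/negP => /card_gt0P[[[]]].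
by rewrite sumr_const card_ffun noS expn0.
Qed.

Lemma value_empty A : value A (empty_diagram ty) = 1.
Proof. exact: value_no_box. Qed.

Lemma value_juxtapose A d1 d2 :
  value A (juxtapose d1 d2) = value A d1 * value A d2.
Proof.
pose join (f : {ffun strings (in_arity ty) (label d1) -> 'I_(\dim {:carrier A})}
             * {ffun strings (in_arity ty) (label d2) -> 'I_(\dim {:carrier A})}) :
    {ffun strings (in_arity ty) (juxt_label (label d1) (label d2)) ->
       'I_(\dim {:carrier A})} :=
  [ffun s => match split_string s with inl s1 => f.1 s1 | inr s2 => f.2 s2 end].
have join_bij : bijective join.
  pose left (f : {ffun strings (in_arity ty) (juxt_label (label d1) (label d2)) ->
      'I_(\dim {:carrier A})}) : {ffun strings (in_arity ty) (label d1) ->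
      'I_(\dim {:carrier A})} := [ffun s => f (join_string (inl s))].
  pose right (f : {ffun strings (in_arity ty) (juxt_label (label d1) (label d2)) ->
      'I_(\dim {:carrier A})}) : {ffun strings (in_arity ty) (label d2) ->
      'I_(\dim {:carrier A})} := [ffun s => f (join_string (inr s))].
  exists (fun f => (left f, right f)).
    move=> [f1 f2]; congr pair; apply/ffunP=> s;
      by rewrite !ffunE join_stringK.
  move=> f; apply/ffunP=> s; rewrite !ffunE -[in RHS](split_stringK s).
  by case: (split_string s) => t; rewrite ffunE.
rewrite /value mulr_suml (reindex join) /=; last exact: onW_bij.
under [RHS]eq_bigr do rewrite mulr_sumr.
rewrite pair_big /=; apply: eq_bigr => -[f1 f2] _ /=.
rewrite big_split_ord /=; congr (_ * _); apply: eq_bigr => b _.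
  have e : juxt_label (label d1) (label d2) (lshift (nboxes d2) b) = label d1 b.
    by rewrite /juxt_label (unsplitK (inl b)).
  have lift_string ar j :
      existT (fun c => 'I_(ar (juxt_label (label d1) (label d2) c)))
        (lshift (nboxes d2) b) j
      = join_string (inl (existT (fun c => 'I_(ar (label d1 c))) b
                           (cast_ord (congr1 ar e) j))).
    exact: eq_tagged_ord.
  apply: (@eq_box_term A _ _ e (congr1 _ e) (congr1 _ e)) => j.
    by rewrite ffunE lift_string /juxt_connection !join_stringK.
  by rewrite ffunE lift_string join_stringK.
have e : juxt_label (label d1) (label d2) (rshift (nboxes d1) b) = label d2 b.
  by rewrite /juxt_label (unsplitK (inr b)).
have lift_string ar j :
    existT (fun c => 'I_(ar (juxt_label (label d1) (label d2) c)))
      (rshift (nboxes d1) b) j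
    = join_string (inr (existT (fun c => 'I_(ar (label d2 c))) b
                         (cast_ord (congr1 ar e) j))).
  exact: eq_tagged_ord.
apply: (@eq_box_term A _ _ e (congr1 _ e) (congr1 _ e)) => j.
  by rewrite ffunE lift_string /juxt_connection !join_stringK.
by rewrite ffunE lift_string join_stringK.
Qed.

Definition zero_structure : algebraic_structure K ty :=
  AlgebraicStructure (carrier := 'rV[K]_0)
    (fun i => Tensor (@zero_form_multilinear K 'rV[K]_0 (ty i).1 (ty i).2)).

Lemma value_zero_structure d : (0 < nboxes d)%N -> value zero_structure d = 0.
Proof.
move=> d_gt0; pose b := Ordinal d_gt0; apply: big1 => f _.
rewrite (bigD1 b) //=.
have zero_term l F G : @box_term zero_structure l F G = 0.
  case: l F G => [i|] F G; first by [].
  have dim0 : \dim {:'rV[K]_0} = 0%N by rewrite dimvf /dim /= muln0.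
  by have := leq_trans (ltn_ord (G ord0)) (eq_leq dim0); rewrite ltn0.
by rewrite [X in X * _](zero_term _ _ _) mul0r.
Qed.

End Value.

(** * The monoid of invariants *)

(* [diagram] gets classical equality and choice only so that it can be quotiented
   with [generic_quotient]. The free vector space on the quotient is the monoid
   algebra of [monalg]; its monomials must form a commutative monoid in which only
   [1] has an inverse, which is checked on the structure [zero_structure]. *)

Section Invariants.
Variables (K : fieldType) (r : nat) (ty : 'I_r -> nat * nat).

HB.instance Definition _ := gen_eqMixin (diagram ty).
HB.instance Definition _ := gen_choiceMixin (diagram ty).

Definition equivalentb (d1 d2 : diagram ty) : bool := `[< equivalent K d1 d2 >].

Lemma equivalentb_equiv : equiv_class_of equivalentb.
Proof.
split=> [d|d1 d2|d2 d1 d3].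
- exact/asboolP.
- by apply: asbool_equiv_eq; split=> h A; rewrite h.
- by move=> /asboolP h1 /asboolP h2; apply/asboolP=> A; rewrite h1.
Qed.

Canonical equivalentb_rel := EquivRelPack equivalentb_equiv.

Definition invariant : Type := {eq_quot equivalentb}.

HB.instance Definition _ := Choice.on invariant.
HB.instance Definition _ := EqQuotient.on invariant.

Definition inv_of (d : diagram ty) : invariant := \pi_invariant d.

Lemma inv_ofP d1 d2 : inv_of d1 = inv_of d2 <-> equivalent K d1 d2.
Proof.
split=> [/eqmodP/asboolP //|h]; exact/eqmodP/asboolP.
Qed.

Lemma inv_ofK (m : invariant) : inv_of (repr m) = m.
Proof. exact: reprK. Qed.

Definition inv_one : invariant := inv_of (empty_diagram ty).
Definition inv_mul (m1 m2 : invariant) : invariant :=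
  inv_of (juxtapose (repr m1) (repr m2)).

Lemma inv_of_juxtapose d1 d2 :
  inv_of (juxtapose d1 d2) = inv_mul (inv_of d1) (inv_of d2).
Proof.
have reprE d : equivalent K (repr (inv_of d)) d.
  by apply/inv_ofP; rewrite inv_ofK.
by apply/inv_ofP=> A; rewrite !value_juxtapose !reprE.
Qed.

Lemma inv_mulA : associative inv_mul.
Proof.
move=> m1 m2 m3; rewrite -[m1]inv_ofK -[m2]inv_ofK -[m3]inv_ofK.
rewrite -!inv_of_juxtapose; apply/inv_ofP=> A.
by rewrite !value_juxtapose mulrA.
Qed.

Lemma inv_mulC : commutative inv_mul.
Proof.
by move=> m1 m2; apply/inv_ofP=> A; rewrite !value_juxtapose mulrC.
Qed.

Lemma inv_mul1 : left_id inv_one inv_mul.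
Proof.
move=> m; rewrite -[m]inv_ofK -inv_of_juxtapose; apply/inv_ofP=> A.
by rewrite value_juxtapose value_empty mul1r.
Qed.

Lemma inv_mulr1 : right_id inv_one inv_mul.
Proof. by move=> m; rewrite inv_mulC inv_mul1. Qed.

Lemma inv_mul_eq1 m1 m2 :
  inv_mul m1 m2 = inv_one -> m1 = inv_one /\ m2 = inv_one.
Proof.
have eq1 m : value (zero_structure K ty) (repr m) != 0 -> m = inv_one.
  move=> nz; rewrite -[m]inv_ofK; apply/inv_ofP=> A.
  case: posnP (@value_zero_structure K r ty (repr m)) => [n0 _|_ /(_ isT) z].
    by rewrite value_empty value_no_box.
  by rewrite z eqxx in nz.
move=> /inv_ofP /(_ (zero_structure K ty)).
rewrite value_juxtapose value_empty => e.
have : value (zero_structure K ty) (repr m1) * value (zero_structure K ty) (repr m2) != 0.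
  by rewrite e oner_neq0.
by rewrite mulf_eq0 negb_or => /andP[/eq1 -> /eq1 ->].
Qed.

HB.instance Definition _ := Choice_isMonomialDef.Build invariant
  inv_mulA inv_mul1 inv_mulr1 inv_mul_eq1.
HB.instance Definition _ := MonomialDef_isConomialDef.Build invariant inv_mulC.

(* An invariant has the property in question when some diagram representing it
   does. *)
Definition unaugmented (m : invariant) : bool :=
  `[< exists d, id_free d /\ m = inv_of d >].

Definition connected (m : invariant) : bool :=
  `[< exists d, connected_diagram d /\ m = inv_of d >].

End Invariants.

(** * The algebras [K[X]_aug], [K[X]] and [K[D]] *)

Section Algebras.
Variables (K : fieldType) (r : nat) (ty : 'I_r -> nat * nat).

Definition KXaug : comAlgType K := {malg K[invariant K ty]}.

Definition invariant_elt (m : invariant K ty) : KXaug := << m >>.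

(* The linear span of the unaugmented invariants. *)
Definition in_KX (a : KXaug) : bool :=
  `[< exists2 s : seq (K * invariant K ty),
        all (fun c => unaugmented c.2) s
      & a = \sum_(c <- s) c.1 *: invariant_elt c.2 >].

Lemma unaugmented1 : unaugmented (mone : invariant K ty).
Proof. by apply/asboolP; exists (empty_diagram ty); split=> //; apply/forallP=> -[]. Qed.

Lemma unaugmentedM (m1 m2 : invariant K ty) :
  unaugmented m1 -> unaugmented m2 -> unaugmented (mmul m1 m2).
Proof.
move=> /asboolP[d1 [/forallP f1 ->]] /asboolP[d2 [/forallP f2 ->]]; apply/asboolP.
exists (juxtapose d1 d2); split; last by rewrite inv_of_juxtapose.
by apply/forallP=> b /=; rewrite /juxt_label; case: (split b).
Qed.

Lemma invariant_eltM m1 m2 :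
  invariant_elt (mmul m1 m2) = invariant_elt m1 * invariant_elt m2.
Proof. by rewrite /invariant_elt -[RHS]/(fgmul _ _) fgmulUU mulr1. Qed.

Lemma in_KX_elt m : unaugmented m -> in_KX (invariant_elt m).
Proof.
by move=> um; apply/asboolP; exists [:: (1, m)]; rewrite /= ?um ?big_seq1 ?scale1r.
Qed.

Lemma in_KX_subalg : GRing.subalg_closed in_KX.
Proof.
have add : {in in_KX &, forall a b, a + b \in in_KX}.
  move=> a b /asboolP[s us ->] /asboolP[t ut ->]; apply/asboolP.
  by exists (s ++ t); rewrite ?all_cat ?us ?big_cat.
have zero : 0 \in in_KX by apply/asboolP; exists [::]; rewrite ?big_nil.
have scale : GRing.scaler_closed in_KX.
  move=> c a /asboolP[s us ->]; apply/asboolP.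
  exists [seq (c * u.1, u.2) | u <- s]; first by rewrite all_map.
  by rewrite scaler_sumr big_map; apply: eq_bigr => u _; rewrite scalerA.
split=> [|c a b Ha Hb|a b].
- exact: in_KX_elt unaugmented1.
- by apply: add => //; apply: scale.
move=> /asboolP[s us ->] /asboolP[t ut ->].
rewrite mulr_suml big_seq; apply: (big_ind (fun a => a \in in_KX)) => // u su.
rewrite mulr_sumr big_seq; apply: (big_ind (fun a => a \in in_KX)) => // v tv.
rewrite -scalerAl -scalerAr -invariant_eltM; do 2!apply: (scale).
by apply: in_KX_elt; apply: unaugmentedM; [apply: (allP us)|apply: (allP ut)].
Qed.

Record KX : Type := MkKX { KX_val :> KXaug; KX_valP : in_KX KX_val }.
HB.instance Definition _ := [isSub for KX_val].
HB.instance Definition _ := [Choice of KX by <:].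
HB.instance Definition _ := GRing.isSubalgClosed.Build K KXaug in_KX in_KX_subalg.
HB.instance Definition _ := [SubChoice_isSubAlgebra of KX by <:].
HB.instance Definition _ := [SubNzRing_isSubComNzRing of KX by <:].

Definition KX_elt (m : invariant K ty) (um : unaugmented m) : KX :=
  MkKX (in_KX_elt um).

Definition dimension_invariant : KXaug := invariant_elt (inv_of K (loop_diagram ty)).

(* The subalgebra generated by [D]. *)
Definition in_KD (a : KXaug) : bool :=
  `[< exists p : {poly K}, a = horner_alg dimension_invariant p >].

Lemma in_KD_D : in_KD dimension_invariant.
Proof. by apply/asboolP; exists 'X; rewrite horner_algX. Qed.

Lemma in_KD_subalg : GRing.subalg_closed in_KD.
Proof.
split=> [|c _ _ /asboolP[p ->] /asboolP[q ->]|_ _ /asboolP[p ->] /asboolP[q ->]].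
- by apply/asboolP; exists 1; rewrite rmorph1.
- by apply/asboolP; exists (c *: p + q); rewrite linearD linearZ /= mulr_algl.
- by apply/asboolP; exists (p * q); rewrite rmorphM.
Qed.

Record KD : Type := MkKD { KD_val :> KXaug; KD_valP : in_KD KD_val }.
HB.instance Definition _ := [isSub for KD_val].
HB.instance Definition _ := [Choice of KD by <:].
HB.instance Definition _ := GRing.isSubalgClosed.Build K KXaug in_KD in_KD_subalg.
HB.instance Definition _ := [SubChoice_isSubAlgebra of KD by <:].
HB.instance Definition _ := [SubNzRing_isSubComNzRing of KD by <:].

Definition KD_D : KD := MkKD in_KD_D.

Definition KX_variables : choiceType :=
  {m : invariant K ty | unaugmented m && connected m}.

Definition KX_variable (x : KX_variables) : KX :=
  KX_elt (proj1 (andP (valP x))).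

End Algebras.

(** * Polynomial algebras and tensor products of algebras *)

(* [{malg K[{cmonom V}]}] is the algebra of polynomials in a possibly infinite
   set [V] of commuting variables. *)
Definition is_polynomial_algebra (K : fieldType) (A : comAlgType K)
    (V : choiceType) (v : V -> A) : Prop :=
  exists phi : {lrmorphism {malg K[{cmonom V}]} -> A},
    bijective phi /\ forall x, phi << ucm x >> = v x.

(* [T], with [t a b] in the role of [a (x) b], is the tensor product over [K] of
   the vector spaces [A] and [B], and its algebra structure is the one of the
   tensor product of algebras. *)
Definition is_tensor_product (K : fieldType) (A B T : comAlgType K)
    (t : A -> B -> T) : Prop :=
  [/\ bilinear_for *:%R *:%R t,
      forall (E : lmodType K) (f : {bilinear A -> B -> E}),
        exists h : {linear T -> E}, (forall a b, h (t a b) = f a b) /\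
          forall h' : {linear T -> E}, (forall a b, h' (t a b) = f a b) -> h' =1 h,
      t 1 1 = 1
    & forall a a' b b', t a b * t a' b' = t (a * a') (b * b')].

(* Main.v *)
Require Import Defs.
From HB Require Import structures.
From mathcomp Require Import all_boot all_order all_algebra.
From mathcomp Require Import finmap zify boolp.
Import GRing.Theory.
Local Open Scope ring_scope.

(** No classification of diagrams up to isomorphism is needed. Write [A + B] for the direct
    sum of two structures. The value of a connected diagram is additive in the
    structure: a contraction of [A + B] along a connected diagram only sees
    contractions inside [A] and inside [B]. Let [1] be the structure on [K] all of
    whose tensors have entry 1; every diagram has value 1 on it. Hence, if a
    product of connected invariants [f_i] equals a product of connected invariants
    [g_j], evaluating at [B + n 1] gives [\prod (n + f_i B) = \prod (n + g_j B)]
    for all natural [n], so in characteristic zero the multisets of the [f_i B]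
    and of the [g_j B] coincide. Choosing [B] such that the distinct invariants
    among the [f_i] and [g_j] take distinct values at [B] (a finite union of proper
    conditions can be avoided along the families [C + n B]) identifies the two
    multisets of invariants. So the monoid of invariants is free commutative on
    its connected elements. Identity reduction and the splitting into connected
    components show that these are [D] and the unaugmented ones, and the
    statements on algebras follow by comparing bases of monomials. *)

Set Implicit Arguments.
Unset Strict Implicit.
Unset Printing Implicit Defensive.

(** * Diagrams with an abstract set of strings *)

Section Nets.
Variables (K : fieldType) (r : nat) (ty : 'I_r -> nat * nat).

(* A box is given by its label and the sequences of names of its output and of its
   input strings; a name occurring as an output and as an input encodes the
   connection of these two strings. *)
Definition box (E : Type) : Type := box_label r * (seq E * seq E).
Definition outs (E : Type) (x : box E) : seq E := x.2.1.
Definition ins (E : Type) (x : box E) : seq E := x.2.2.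

Definition relabel (E E' : Type) (h : E -> E') (x : box E) : box E' :=
  (x.1, (map h (outs x), map h (ins x))).

Definition well_typed (E : Type) (x : box E) : bool :=
  (size (outs x) == out_arity ty x.1) && (size (ins x) == in_arity ty x.1).

Definition closed_net (E : finType) (bs : seq (box E)) : Prop :=
  [/\ all (@well_typed E) bs,
      forall e, count_mem e (flatten (map (@outs E) bs)) = 1%N
    & forall e, count_mem e (flatten (map (@ins E) bs)) = 1%N].

(* The coordinates of the tensors of a structure in a basis indexed by
   [index_type]. The entries at sequences of the wrong length are junk. *)
Record weights := Weights {
  index_type : finType;
  entry : 'I_r -> seq index_type -> seq index_type -> K }.

Definition weight (w : weights) (l : box_label r) (s t : seq (index_type w)) : K :=
  if l is Some i then entry i s t else (s == t)%:R.

Definition net_value (w : weights) (E : finType) (bs : seq (box E)) : K :=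
  \sum_(f : {ffun E -> index_type w})
    \prod_(x <- bs) @weight w x.1 (map f (outs x)) (map f (ins x)).

Lemma perm_net_value w (E : finType) (bs bs' : seq (box E)) :
  perm_eq bs bs' -> net_value w bs = net_value w bs'.
Proof. by move=> p; apply: eq_bigr => f _; apply: perm_big. Qed.

Lemma perm_closed_net (E : finType) (bs bs' : seq (box E)) :
  perm_eq bs bs' -> closed_net bs -> closed_net bs'.
Proof.
move=> p [wt co ci]; split.
- by rewrite -(perm_all _ p).
- by move=> e; rewrite -(permP (perm_flatten (perm_map (@outs E) p))).
- by move=> e; rewrite -(permP (perm_flatten (perm_map (@ins E) p))).
Qed.

Lemma net_value_relabel w (E E' : finType) (h : E -> E') (bs : seq (box E)) :
  bijective h -> net_value w (map (relabel h) bs) = net_value w bs.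
Proof.
move=> [g hK gK]; rewrite /net_value.
rewrite [RHS](reindex (fun f : {ffun E' -> index_type w} => [ffun e => f (h e)])) /=.
  apply: eq_bigr => f _; rewrite big_map; apply: eq_bigr => x _.
  by rewrite /outs /ins -!map_comp; congr (weight _ _); apply: eq_map => e /=;
    rewrite ffunE.
exists (fun f : {ffun E -> index_type w} => [ffun e => f (g e)]) => f _;
  by apply/ffunP => e; rewrite !ffunE ?hK ?gK.
Qed.

(** A colouring of a disjoint union of names is a pair of colourings, so the sum factors. *)
Lemma net_value_sum w (E E' : finType) (bs : seq (box E)) (bs' : seq (box E')) :
  net_value w (map (relabel inl) bs ++ map (relabel inr) bs')
  = net_value w bs * net_value w bs'.
Proof.
rewrite /net_value mulr_suml.
under [RHS]eq_bigr do rewrite mulr_sumr.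
rewrite pair_big /=.
pose join (p : {ffun E -> index_type w} * {ffun E' -> index_type w}) :
    {ffun E + E' -> index_type w} :=
  [ffun e => match e with inl x => p.1 x | inr y => p.2 y end].
rewrite (reindex join) /=.
  apply: eq_bigr => p _; rewrite big_cat !big_map; congr (_ * _);
    by apply: eq_bigr => x _; rewrite /outs /ins -!map_comp;
       congr (weight _ _); apply: eq_map => e /=; rewrite ffunE.
exists (fun f : {ffun E + E' -> index_type w} =>
          ([ffun e => f (inl e)], [ffun e => f (inr e)])).
  by move=> [p1 p2] _; congr pair; apply/ffunP=> e; rewrite !ffunE.
by move=> f _; apply/ffunP => -[e|e]; rewrite !ffunE.
Qed.

(** As in [value], a connected pair is named after its input string; an output string bears the name
    of the input it is connected to. *)
Definition diagram_box (d : diagram ty) (b : 'I_(nboxes d)) :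
    box (strings (in_arity ty) (label d)) :=
  (label d b,
   ([seq connection (existT (fun b => 'I_(out_arity ty (label d b))) b j)
      | j <- enum 'I_(out_arity ty (label d b))],
    [seq existT (fun b => 'I_(in_arity ty (label d b))) b j
      | j <- enum 'I_(in_arity ty (label d b))])).

Definition diagram_net (d : diagram ty) : seq (box (strings (in_arity ty) (label d))) :=
  map (@diagram_box d) (enum 'I_(nboxes d)).

Lemma flatten_strings (ar : box_label r -> nat) n (lab : 'I_n -> box_label r) :
  perm_eq (flatten [seq [seq existT (fun b => 'I_(ar (lab b))) b j
                          | j <- enum 'I_(ar (lab b))] | b <- enum 'I_n])
          (enum {: strings ar lab}).
Proof.
apply: uniq_perm; last 2 first.
- exact: enum_uniq.
- move=> [b j]; rewrite mem_enum inE; apply/flatten_mapP.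
  by exists b; rewrite ?mem_enum //; apply: map_f; rewrite mem_enum.
apply: allpairs_uniq_dep => [|b _|].
- exact: enum_uniq.
- exact: enum_uniq.
by move=> [b j] [b' j'].
Qed.

Lemma diagram_net_closed d : closed_net (diagram_net d).
Proof.
have [g gK Kg] := connection_bij d.
split.
- by apply/allP => x /mapP[b _ ->]; apply/andP; split; rewrite /= size_map size_enum_ord.
- move=> e; rewrite -map_comp.
  (* The output names are the images under the connection of all output strings, each listed once;
     since the connection is bijective, each name occurs once. *)
  have -> : flatten [seq (@outs _ \o @diagram_box d) i | i <- enum 'I_(nboxes d)]
     = map (@connection _ _ d)
         (flatten [seq [seq existT (fun b => 'I_(out_arity ty (label d b))) b j
                          | j <- enum 'I_(out_arity ty (label d b))]
                    | b <- enum 'I_(nboxes d)]).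
    rewrite map_flatten -[in RHS]map_comp; congr flatten.
    by apply: eq_map => b; rewrite /= -map_comp.
  rewrite count_map (eq_count (a2 := pred1 (g e))); last first.
    by move=> s /=; rewrite (can2_eq gK Kg).
  by rewrite (permP (flatten_strings _ _)) count_uniq_mem ?enum_uniq // mem_enum.
- move=> e; rewrite -map_comp.
  by rewrite (permP (flatten_strings _ _)) count_uniq_mem ?enum_uniq // mem_enum.
Qed.


(** * From closed nets back to closed diagrams *)

Section Positions.
Variables (E : finType) (n : nat) (lab : 'I_n -> box_label r).
Variables (ar : box_label r -> nat) (side : 'I_n -> seq E).
Hypothesis side_size : forall b, size (side b) = ar (lab b).
Hypothesis side_count : forall e, count_mem e (flatten (map side (enum 'I_n))) = 1%N.

Definition string_edge (s : strings ar lab) : E :=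
  tnth (in_tuple (side (tag s))) (cast_ord (esym (side_size (tag s))) (tagged s)).

Lemma map_string_edge b :
  [seq string_edge (existT (fun b => 'I_(ar (lab b))) b j) | j <- enum 'I_(ar (lab b))]
  = side b.
Proof.
rewrite -[RHS](map_tnth_enum (in_tuple (side b))).
have main : forall m (e : m = size (side b)),
    [seq tnth (in_tuple (side b)) (cast_ord e j) | j <- enum 'I_m]
    = [seq tnth (in_tuple (side b)) i | i <- enum 'I_(size (side b))].
  by move=> m e; subst m; apply: eq_map => j; rewrite cast_ord_id.
exact: (main _ (esym (side_size b))).
Qed.

(** Every name occurs, which gives surjectivity. It occurs once only, so there are as many strings
    as names, and a section of the surjection is bijective by cardinality. *)
Lemma string_edge_bij : bijective string_edge.
Proof.
have ex e : {s | string_edge s = e}.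
  apply: cid.
  have : e \in flatten (map side (enum 'I_n)) by rewrite -has_pred1 has_count side_count.
  case/flatten_mapP=> b _; rewrite -map_string_edge => /mapP[j _ ->].
  by eexists.
have Kg : cancel (fun e => sval (ex e)) string_edge by move=> e; exact: svalP (ex e).
have szE : #|{: strings ar lab}| = #|E|.
  rewrite cardE -(perm_size (flatten_strings ar lab)) cardE.
  have /perm_size <- : perm_eq (flatten (map side (enum 'I_n))) (enum E).
    apply/allP => e _ /=; rewrite side_count count_uniq_mem ?enum_uniq //.
    by rewrite mem_enum.
  rewrite !size_flatten /shape -!map_comp; congr sumn; apply: eq_map => b /=.
  by rewrite size_map size_enum_ord side_size.
have [h hK Kh] := inj_card_bij (can_inj Kg) (eq_leq szE).
by exists (fun e => sval (ex e)) => // s; rewrite -[s in LHS]Kh Kg Kh.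
Qed.

End Positions.

(** The connection sends an output string to its name, then to the input string with the same name.
    Renaming the strings of this diagram by [string_edge si] gives back [bs]. *)
Lemma closed_net_diagram (E : finType) (bs : seq (box E)) : closed_net bs ->
  exists d : diagram ty,
    [/\ nboxes d = size bs,
        forall w, net_value w (diagram_net d) = net_value w bs
      & all (fun x => x.1 != None) bs -> id_free d].
Proof.
move=> [/allP wt co ci].
pose bx i := tnth (in_tuple bs) i.
have bxP i : well_typed (bx i) by apply: wt; exact: mem_tnth.
pose lab i := (bx i).1.
have bsE : bs = map bx (enum 'I_(size bs)).
  by rewrite [LHS](esym (map_tnth_enum (in_tuple bs))).
have so i : size (outs (bx i)) = out_arity ty (lab i) by have /andP[/eqP] := bxP i.
have si i : size (ins (bx i)) = in_arity ty (lab i) by have /andP[_ /eqP] := bxP i.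
have co' e : count_mem e (flatten (map (@outs E \o bx) (enum 'I_(size bs)))) = 1%N.
  by rewrite map_comp -bsE co.
have ci' e : count_mem e (flatten (map (@ins E \o bx) (enum 'I_(size bs)))) = 1%N.
  by rewrite map_comp -bsE ci.
have bo := string_edge_bij so co'.
have [g gK Kg] := string_edge_bij si ci'.
have cb : bijective (g \o string_edge so).
  by apply: bij_comp bo; exists (string_edge si).
exists (Diagram cb); split=> //.
  move=> w; rewrite [in RHS]bsE.
  rewrite -(net_value_relabel w (h := string_edge si)); last by exists g.
  rewrite /diagram_net -map_comp; congr net_value; apply: eq_map => i /=.
  rewrite [RHS]surjective_pairing; congr pair.
  rewrite [RHS]surjective_pairing; congr pair.
    rewrite -[RHS](map_string_edge so) -map_comp.
    by apply: eq_map => j /=; rewrite Kg.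
  by rewrite -[RHS](map_string_edge si) -map_comp.
by move=> /allP h; apply/forallP => i; apply: h; exact: mem_tnth.
Qed.

End Nets.

(** * Structures in coordinates *)

Section Realization.
Variables (K : fieldType) (r : nat) (ty : 'I_r -> nat * nat).

(** Index sequences that are too short are completed by the default value 0 of [nth]; well-typed
    boxes never use these entries. *)
Definition structure_weights (A : algebraic_structure K ty) : weights K r :=
  Weights (fun i (s t : seq 'I_(\dim {:carrier A})) =>
    structure_tensor A i [ffun j : 'I__ => [seq basis_covec k | k <- s]`_j]
                         [ffun j : 'I__ => [seq basis_vec k | k <- t]`_j]).

Lemma basis_covecE (W : vectType K) (j k : 'I_(\dim {:W})) :
  basis_covec j (basis_vec k) = (j == k)%:R.
Proof. by rewrite lfunE /= coord_free ?(basis_free (vbasisP _)) // eq_sym. Qed.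

Lemma box_tensor_weight A l (F : 'I_(out_arity ty l) -> 'I_(\dim {:carrier A}))
    (G : 'I_(in_arity ty l) -> 'I_(\dim {:carrier A})) :
  box_tensor A l [ffun j => basis_covec (F j)] [ffun j => basis_vec (G j)]
  = @weight _ _ (structure_weights A) l (map F (enum 'I__)) (map G (enum 'I__)).
Proof.
case: l F G => [i|] F G /=.
  congr (structure_tensor A i _ _); apply/ffunP => j; rewrite !ffunE -map_comp;
    by rewrite (nth_map j) ?size_enum_ord // nth_ord_enum.
rewrite /id_form !ffunE basis_covecE !enum_ordSl !enum_ord0 /=.
by rewrite eqseq_cons andbT.
Qed.

Lemma value_net A (d : diagram ty) :
  value A d = net_value (structure_weights A) (diagram_net d).
Proof.
apply: eq_bigr => f _; rewrite big_map big_enum; apply: eq_bigr => b _.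
rewrite box_tensor_weight /outs /ins /=.
by congr weight; rewrite -[RHS]map_comp.
Qed.

(** Only the factor of index [i] depends on [a]. *)
Lemma prod_subst_at_linear (V : lmodType K) n (g : 'I_n -> V -> K)
    (u : {ffun 'I_n -> V}) (i : 'I_n) :
  linear (g i : V -> K^o) ->
  linear (fun a => \prod_j g j (subst_at u i a j) : K^o).
Proof.
have E a : \prod_j g j (subst_at u i a j) = g i a * \prod_(j | j != i) g j (u j).
  rewrite (bigD1 i) //= ffunE eqxx; congr (_ * _).
  by apply: eq_bigr => j /negbTE ji; rewrite ffunE ji.
by move=> lin c x y; rewrite !E lin [LHS]mulrDl -[in LHS]mulrA.
Qed.

(** * The structure with given coordinates *)

Section WeightsStructure.
Variable w : weights K r.

Let W : vectType K := 'rV[K]_#|index_type w|.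

Lemma dim_weights_carrier : #|index_type w| = \dim {:W}.
Proof. by rewrite dimvf /dim /= mul1n. Qed.

Definition index_basis (x : index_type w) : 'I_(\dim {:W}) :=
  cast_ord dim_weights_carrier (enum_rank x).

Lemma index_basis_bij : bijective index_basis.
Proof.
exists (fun j => enum_val (cast_ord (esym dim_weights_carrier) j)) => x.
  by rewrite /index_basis cast_ordK enum_rankK.
by rewrite /index_basis enum_valK cast_ordKV.
Qed.

(** This is the tensor with coordinates [c] in the basis [index_basis], a sum over multi-indices [a]
    and [b], read as a multilinear form. *)
Definition weights_form p q (c : seq (index_type w) -> seq (index_type w) -> K)
    (xi : {ffun 'I_p -> 'Hom(W, K^o)}) (v : {ffun 'I_q -> W}) : K :=
  \sum_(a : {ffun 'I_p -> index_type w}) \sum_(b : {ffun 'I_q -> index_type w})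
    c (map a (enum 'I_p)) (map b (enum 'I_q))
    * ((\prod_j xi j (basis_vec (index_basis (a j))))
       * \prod_j basis_covec (index_basis (b j)) (v j)).

Lemma weights_form_multilinear p q c : multilinear (@weights_form p q c).
Proof.
split=> [v xi i|xi v i] k x y; rewrite /weights_form scaler_sumr -big_split;
  apply: eq_bigr => a _ /=; rewrite scaler_sumr -big_split; apply: eq_bigr => b _ /=.
  have lin : linear (fun f : 'Hom(W, K^o) => f (basis_vec (index_basis (a i))) : K^o).
    by move=> d f g; rewrite add_lfunE scale_lfunE.
  have := @prod_subst_at_linear _ _ (fun j (f : 'Hom(W, K^o)) =>
    f (basis_vec (index_basis (a j)))) xi i lin k x y.
  by move=> /= ->; rewrite [in LHS]mulrDl [in LHS]mulrDr -[in LHS]mulrA [in LHS]mulrCA.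
have := @prod_subst_at_linear _ _ (fun j => basis_covec (index_basis (b j))) v i
  (linearP _) k x y.
by move=> /= ->; rewrite 2!mulrDr; congr (_ + _); rewrite /GRing.scale /= ![_ * (k * _)]mulrCA.
Qed.

Definition weights_structure : algebraic_structure K ty :=
  AlgebraicStructure (carrier := W)
    (fun i => Tensor (@weights_form_multilinear (ty i).1 (ty i).2 (@entry _ _ w i))).

Lemma prod_eq_natr (n : nat) (T : finType) (a b : {ffun 'I_n -> T}) :
  \prod_j (a j == b j)%:R = (a == b)%:R :> K.
Proof.
have [->|neq] := eqVneq; first by rewrite big1 // => j _; rewrite eqxx.
have [j ne] : exists j, a j != b j.
  by apply/existsP; rewrite -negb_forall; apply: contra neq => /forallP h;
    apply/eqP/ffunP => j; exact/eqP.
by rewrite (bigD1 j) //= (negbTE ne) mul0r.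
Qed.

(** By duality of the bases, only the term with multi-indices [F] and [G] survives in the form. *)
Lemma weights_structure_box l (F : 'I_(out_arity ty l) -> index_type w)
    (G : 'I_(in_arity ty l) -> index_type w) :
  box_tensor weights_structure l [ffun j => basis_covec (index_basis (F j))]
    [ffun j => basis_vec (index_basis (G j))]
  = weight l (map F (enum 'I__)) (map G (enum 'I__)).
Proof.
have inj := bij_inj index_basis_bij.
case: l F G => [i|] F G /=; last first.
  rewrite /id_form !ffunE basis_covecE (inj_eq inj) !enum_ordSl !enum_ord0 /=.
  by rewrite eqseq_cons andbT.
pose F' : {ffun 'I_(ty i).1 -> _} := finfun F; pose G' : {ffun 'I_(ty i).2 -> _} := finfun G.
have E1 (a : {ffun 'I_(ty i).1 -> index_type w}) :
    \prod_j [ffun j => @basis_covec K W (index_basis (F j))] j (basis_vec (index_basis (a j)))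
    = (F' == a)%:R.
  rewrite -prod_eq_natr; apply: eq_bigr => j _.
  by rewrite !ffunE basis_covecE (inj_eq inj).
have E2 (b : {ffun 'I_(ty i).2 -> index_type w}) :
    \prod_j basis_covec (index_basis (b j)) ([ffun j => @basis_vec K W (index_basis (G j))] j)
    = (b == G')%:R.
  rewrite -prod_eq_natr; apply: eq_bigr => j _.
  by rewrite !ffunE basis_covecE (inj_eq inj).
transitivity (\sum_(a : {ffun 'I_(ty i).1 -> index_type w})
  \sum_(b : {ffun 'I_(ty i).2 -> index_type w})
    entry i (map a (enum 'I_(ty i).1)) (map b (enum 'I_(ty i).2))
    * ((F' == a)%:R * (b == G')%:R)).
  by apply: eq_bigr => a _; apply: eq_bigr => b _; rewrite -E1 -E2.
rewrite (bigD1 F') //= (bigD1 G') //= !eqxx !mulr1 !big1 ?addr0.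
- by congr entry; apply: eq_map => j; rewrite ffunE.
- by move=> a; rewrite eq_sym => /negbTE ->; apply: big1 => b _; rewrite mul0r mulr0.
- by move=> b /negbTE ->; rewrite mulr0 mulr0.
Qed.

(** Together with [value_net], this allows equivalence of diagrams to be tested on weights instead
    of structures. *)
Lemma value_weights_structure (d : diagram ty) :
  value weights_structure d = net_value w (diagram_net d).
Proof.
have [g gK Kg] := index_basis_bij.
pose S := strings (in_arity ty) (label d).
rewrite /value (reindex (fun f : {ffun S -> index_type w} =>
   [ffun e => index_basis (f e)])) /=; last first.
  exists (fun f => [ffun e => g (f e)]) => f _;
  by apply/ffunP => e; rewrite !ffunE ?gK ?Kg.
apply: eq_bigr => f _; rewrite big_map big_enum; apply: eq_bigr => b _ /=.
rewrite /outs /ins /=; transitivity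
  (weight (label d b)
    [seq f (connection (existT (fun b => 'I_(out_arity ty (label d b))) b j)) | j <- enum 'I__]
    [seq f (existT (fun b => 'I_(in_arity ty (label d b))) b j) | j <- enum 'I__]).
  rewrite -weights_structure_box; apply: (f_equal2 (box_tensor weights_structure (label d b)));
    by apply/ffunP => j; rewrite !ffunE.
by congr weight; rewrite -[RHS]map_comp.
Qed.

End WeightsStructure.
End Realization.

(** * Identity reduction and connected components *)

Section Decomposition.
Variables (K : fieldType) (r : nat) (ty : 'I_r -> nat * nat).

Lemma relabel_comp (E E' E'' : Type) (h : E' -> E'') (g : E -> E') (x : box r E) :
  relabel h (relabel g x) = relabel (h \o g) x.
Proof. by rewrite /relabel /outs /ins /= -!map_comp. Qed.

Lemma relabel_outs (E E' : Type) (h : E -> E') (bs : seq (box r E)) :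
  flatten (map (@outs r E') (map (relabel h) bs)) = map h (flatten (map (@outs r E) bs)).
Proof. by rewrite map_flatten -!map_comp; congr flatten; apply: eq_map. Qed.

Lemma relabel_ins (E E' : Type) (h : E -> E') (bs : seq (box r E)) :
  flatten (map (@ins r E') (map (relabel h) bs)) = map h (flatten (map (@ins r E) bs)).
Proof. by rewrite map_flatten -!map_comp; congr flatten; apply: eq_map. Qed.

Lemma relabel_label (E E' : Type) (h : E -> E') (bs : seq (box r E)) :
  map fst (map (relabel h) bs) = map fst bs.
Proof. by rewrite -map_comp; apply: eq_map. Qed.

Lemma relabel_well_typed (E E' : Type) (h : E -> E') (bs : seq (box r E)) :
  all (@well_typed r ty E') (map (relabel h) bs) = all (@well_typed r ty E) bs.
Proof. by rewrite all_map; apply: eq_all => x; rewrite /well_typed /= !size_map. Qed.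

Lemma restrict_net (E : finType) (P : pred E) (bs : seq (box r E)) :
  all (fun x => all P (outs x) && all P (ins x)) bs ->
  exists bs' : seq (box r {e | P e}), bs = map (relabel val) bs'.
Proof.
have lift s : all P s -> exists s' : seq {e | P e}, s = map val s'.
  elim: s => [|e s IH] /=; first by exists [::].
  by case/andP=> Pe /IH[s' ->]; exists (Sub e Pe :: s').
elim: bs => [|[l [o i]] bs IH] /=; first by exists [::].
case/andP=> /andP[/lift[o' +] /lift[i' +]] /IH[bs' ->]; rewrite /outs /ins /= => -> ->.
by exists ((l, (o', i')) :: bs').
Qed.

(** No box mixes names in [P] with names outside, so the net is a disjoint union of two closed nets
    up to renaming, and [net_value_sum] applies. *)
Lemma split_net (E : finType) (P : pred E) (bs1 bs2 : seq (box r E)) :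
  closed_net ty (bs1 ++ bs2) ->
  all (fun x => all P (outs x) && all P (ins x)) bs1 ->
  all (fun x => all (predC P) (outs x) && all (predC P) (ins x)) bs2 ->
  exists (E1 E2 : finType) (bs1' : seq (box r E1)) (bs2' : seq (box r E2)),
    [/\ closed_net ty bs1', closed_net ty bs2',
        map fst bs1' = map fst bs1, map fst bs2' = map fst bs2
      & forall w : weights K r, net_value w (bs1 ++ bs2) = net_value w bs1' * net_value w bs2'].
Proof.
move=> [wt co ci] /restrict_net[bs1' def1] /restrict_net[bs2' def2].
exists {e | P e}, {e | predC P e}, bs1', bs2'.
move: wt; rewrite all_cat def1 def2 !relabel_well_typed => /andP[wt1 wt2].
(* Names outside [Q] do not occur, and the others are counted as in the subtype. *)
have countP (Q : pred E) e (s : seq {e | Q e}) :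
    count_mem e (map val s) = if insub e is Some e' then count_mem e' s else 0%N.
  case: insubP => [e' _ <-|ne]; first by rewrite count_map; apply: eq_count.
  by apply/count_memPn; apply: contra ne => /mapP[e' _ ->]; exact: valP.
have split_count (g : forall E' : finType, box r E' -> seq E') :
    (forall (E' : finType) (h : E' -> E) bs,
       flatten (map (@g E) (map (relabel h) bs)) = map h (flatten (map (@g E') bs))) ->
    (forall e, count_mem e (flatten (map (@g E) (bs1 ++ bs2))) = 1%N) ->
    (forall e, count_mem e (flatten (map (@g _) bs1')) = 1%N) /\
    (forall e, count_mem e (flatten (map (@g _) bs2')) = 1%N).
  move=> gE ce; split=> e; move: (ce (val e));
    rewrite map_cat flatten_cat count_cat def1 def2 !gE !countP valK.
    by rewrite insubF ?addn0 //= (valP e).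
  by rewrite [X in (X + _)%N](_ : _ = 0%N) // insubF //; apply: negbTE (valP e).
have [co1 co2] := split_count (fun E' => @outs r E') (@relabel_outs ^~ E) co.
have [ci1 ci2] := split_count (fun E' => @ins r E') (@relabel_ins ^~ E) ci.
split=> //; rewrite ?relabel_label // => w.
pose h (e : {e | P e} + {e | predC P e}) : E :=
  match e with inl e => val e | inr e => val e end.
rewrite -net_value_sum -(@net_value_relabel _ _ w _ _ h).
  by rewrite map_cat -!(map_comp (relabel h)); congr (net_value _ (_ ++ _));
    apply: eq_map => x; rewrite /= relabel_comp.
pose g (e : E) : {e | P e} + {e | predC P e} :=
  match boolP (P e) with
  | AltTrue p => inl (exist (fun e => P e) e p)
  | AltFalse p => inr (exist (fun e => predC P e) e p)
  end.
exists g => [[e|e]|e]; rewrite /g /=.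
- by case: {-}_ / boolP => p; [congr inl; apply: val_inj | have := valP e; rewrite (negbTE p)].
- by case: {-}_ / boolP => p; [have := valP e; rewrite /= p | congr inr; apply: val_inj].
by case: {-}_ / boolP.
Qed.

(** Closedness forces [E] to have a single name, used on both sides of the box; each of its
    colourings contributes 1. *)
Lemma loop_net_value (E : finType) s t (w : weights K r) :
  closed_net ty [:: (None, (s, t)) : box r E] ->
  net_value w [:: (None, (s, t)) : box r E] = #|index_type w|%:R.
Proof.
case; rewrite /well_typed /outs /ins /= !cats0 andbT.
case: s t => [|a []] // [|b []] // _ ca cb.
have Ea e : e = a by have := ca e; rewrite /= eq_sym; case: eqP.
rewrite /net_value (eq_bigr (fun=> 1)); last first.
  by move=> f _; rewrite big_seq1 /outs /ins /= (Ea b) eqxx.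
rewrite sumr_const card_ffun (_ : #|E| = 1%N) ?expn1 //.
by rewrite -cardsT; apply/eqP/cards1P; exists a; apply/setP => e; rewrite !inE (Ea e) eqxx.
Qed.

(** Identity reduction. The identity box contributes a Kronecker symbol, so only colourings with
    equal values at [e] and [e'] count; they are the colourings of the names after [e] is merged
    into [e']. *)
Lemma reduce_net (E : finType) e e' (bs : seq (box r E)) :
  e != e' -> closed_net ty ((None, ([:: e], [:: e'])) :: bs) ->
  exists (E' : finType) (bs' : seq (box r E')),
    [/\ closed_net ty bs', map fst bs' = map fst bs
      & forall w : weights K r,
          net_value w ((None, ([:: e], [:: e'])) :: bs) = net_value w bs'].
Proof.
move=> neq [/andP[_ wt] co ci].
have ne' : e' != e by rewrite eq_sym.
pose E' : finType := {y | y != e}.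
(* The default value of [insubd] does the merging: it is taken at [e] only. *)
pose h y : E' := insubd (Sub e' ne') y.
have hE y : val (h y) = if y == e then e' else y by rewrite val_insubd; case: eqP.
have hv (z : E') : h (val z) = z by apply: val_inj; rewrite hE (negbTE (valP z)).
exists E', (map (relabel h) bs).
have counth (z : E') s :
    count_mem z (map h s) = (count_mem (val z) s + (val z == e') * count_mem e s)%N.
  rewrite count_map; elim: s => [|y s IH] /=; first by rewrite muln0.
  rewrite IH -val_eqE hE /=; have nz : val z != e := valP z.
  have [->|ye] := eqVneq y e; last by rewrite add0n addnA.
  by rewrite [e == _]eq_sym (negbTE nz) [e' == _]eq_sym; lia.
split; rewrite ?relabel_label //.
(* In [bs], the name [e] is left only as an input and [e'] only as an output, so the merged name
   occurs once on each side. *)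
- split; first by rewrite relabel_well_typed.
    move=> z; rewrite relabel_outs counth.
    have := co (val z); have := co e; rewrite /= eqxx [e == _]eq_sym (negbTE (valP z)).
    by rewrite /outs /=; lia.
  move=> z; rewrite relabel_ins counth.
  have := ci (val z); have := ci e; rewrite /= (negbTE ne') [e' == _]eq_sym /ins /=.
  by lia.
move=> w; rewrite /net_value.
under eq_bigr do rewrite big_cons /= eqseq_cons andbT mulr_natl mulrb.
rewrite -big_mkcond /= (reindex_onto (fun g : {ffun E' -> index_type w} => [ffun y => g (h y)])
  (fun f => [ffun z => f (val z)])) /=; last first.
  by move=> f /eqP fe; apply/ffunP => y; rewrite !ffunE hE; case: eqP => // ->.
apply: eq_big => [g|g _].
  have hee' : h e = h e' by apply: val_inj; rewrite !hE eqxx (negbTE ne').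
  by rewrite !ffunE hee' eqxx; apply/eqP/ffunP => z; rewrite !ffunE hv.
rewrite big_map; apply: eq_bigr => x _.
by congr weight; rewrite -[RHS]map_comp; apply: eq_map => y; rewrite ffunE.
Qed.


Local Notation inv := (inv_of K).

Lemma inv_of_net_mul (d d1 d2 : diagram ty) :
  (forall w : weights K r, net_value w (diagram_net d)
     = net_value w (diagram_net d1) * net_value w (diagram_net d2)) ->
  inv d = mmul (inv d1) (inv d2).
Proof.
move=> h; rewrite -[RHS](inv_of_juxtapose K); apply/inv_ofP => A.
by rewrite value_juxtapose !value_net.
Qed.

Lemma size_labels (E E' : Type) (bs : seq (box r E)) (bs' : seq (box r E')) :
  map fst bs = map fst bs' -> size bs = size bs'.
Proof. by move=> /(congr1 size); rewrite !size_map. Qed.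

(** Induction on the number of boxes: an identity box is either bypassed by [reduce_net], or it is a
    loop and splits off with the dimension as a factor. *)
Lemma remove_identities n (E : finType) (bs : seq (box r E)) :
  (size bs <= n)%N -> closed_net ty bs ->
  exists (k : nat) (d : diagram ty), id_free d /\
    forall w : weights K r,
      net_value w bs = #|index_type w|%:R ^+ k * net_value w (diagram_net d).
Proof.
elim: n E bs => [|n IH] E bs.
  rewrite leqn0 size_eq0 => /eqP -> cl; exists 0%N.
  have [d [_ nv idf]] := closed_net_diagram K cl.
  by exists d; split=> [|w]; rewrite ?idf // nv mul1r.
move=> size_bs cl; have [none_free|] := boolP (all (fun x => x.1 != None) bs).
  have [d [_ nv idf]] := closed_net_diagram K cl.
  by exists 0%N, d; split=> [|w]; rewrite ?idf // nv mul1r.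
case/allPn=> x x_bs /negPn/eqP x_id.
have pbs := perm_to_rem x_bs.
have {}cl := perm_closed_net pbs cl.
have size_rem_bs : (size (rem x bs) <= n)%N by rewrite size_rem // -subn1 leq_subLR.
have nvE (w : weights K r) := perm_net_value w pbs.
move: (rem x bs) size_rem_bs cl nvE => bs0 size_bs0 cl nvE {pbs}.
have /andP[] : well_typed ty x by case: cl => /andP[].
move: cl nvE; case: x x_id {x_bs} => _ [o i] /= -> cl nvE; rewrite /outs /ins /=.
case: o cl nvE => [|e []] // cl nvE _; case: i cl nvE => [|e' []] // cl nvE _.
have [ee'|neq] := eqVneq e e'; last first.
  have [E' [bs' [cl' /size_labels szE nv]]] := reduce_net neq cl.
  have [|k [d [idf nvd]]] := IH _ bs' _ cl'; first by rewrite szE.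
  by exists k, d; split=> // w; rewrite nvE nv nvd.
rewrite -{}ee' in cl nvE.
have [||E1 [E2 [bs1 [bs2 [cl1 cl2 lab1 lab2 nv]]]]] :=
    @split_net E (pred1 e) [:: (None, ([:: e], [:: e]))] bs0 cl.
- by rewrite /= eqxx.
(* The loop uses up both occurrences of [e], so no other box carries this name. *)
- case: cl => _ co ci; apply/allP => y y_bs0; apply/andP; split; apply/allP => e1 e1y /=;
    apply/eqP => e1e.
    have := co e; rewrite /= {1}/outs /= eqxx add1n => -[] /count_memPn/flattenP; apply.
    by exists (outs y); [apply: map_f | rewrite -e1e].
  have := ci e; rewrite /= {1}/ins /= eqxx add1n => -[] /count_memPn/flattenP; apply.
  by exists (ins y); [apply: map_f | rewrite -e1e].
have [|k [d [idf nvd]]] := IH _ bs2 _ cl2; first by rewrite (size_labels lab2).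
exists k.+1, d; split=> // w; rewrite nvE (nv w) nvd mulrA exprS; congr (_ * _ * _).
case: bs1 cl1 lab1 {nv} => [|[l [s t]] []] //= cl1 [l_id].
by rewrite l_id in cl1 *; exact: loop_net_value.
Qed.

Lemma loop_diagram_value (w : weights K r) :
  net_value w (diagram_net (loop_diagram ty)) = #|index_type w|%:R.
Proof.
have := diagram_net_closed (loop_diagram ty).
by rewrite /diagram_net enum_ordSl enum_ord0; exact: loop_net_value.
Qed.

(** * Splitting into connected components *)

Lemma diagram_edges (d : diagram ty) (C : pred 'I_(nboxes d)) b :
  (forall b b', adjacent b b' -> C b = C b') ->
  all (fun e => C (tag e) == C b) (outs (diagram_box b)) &&
  all (fun e => C (tag e) == C b) (ins (diagram_box b)).
Proof.
move=> adjC; apply/andP; split; apply/allP => e /mapP[j _ ->] //=.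
rewrite eq_sym; apply/eqP/adjC/existsP; eexists; apply/andP; split; last exact: eqxx.
exact: eqxx.
Qed.

(** The component [C] of a box [b0] is separated from the remaining boxes. Both parts are proper,
    since [C] contains [b0] and misses some [b1]. *)
Lemma split_disconnected (d : diagram ty) :
  (0 < nboxes d)%N -> ~~ connected_diagram d -> id_free d ->
  exists d1 d2 : diagram ty,
    [/\ inv d = mmul (inv d1) (inv d2), id_free d1 /\ id_free d2
      & (nboxes d1 < nboxes d)%N /\ (nboxes d2 < nboxes d)%N].
Proof.
rewrite /connected_diagram => -> /= /forallPn[b0 /forallPn[b1 nconn]] idf.
pose R := fun c c' : 'I_(nboxes d) => adjacent c c' || adjacent c' c.
pose C : pred 'I_(nboxes d) := fun c => connect R b0 c.
have R_sym : symmetric R by move=> x y; rewrite /R orbC.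
have adjC b b' : adjacent b b' -> C b = C b'.
  move=> bb'; have Rbb' : R b b' by rewrite /R bb'.
  exact: (same_connect_r (sym_connect_sym R_sym) (connect1 Rbb')).
have C0 : C b0 by apply: connect0.
have C1 : ~~ C b1 by [].
pose bs (Q : pred 'I_(nboxes d)) := map (@diagram_box r ty d) (filter Q (enum 'I_(nboxes d))).
have pbs : perm_eq (diagram_net d) (bs C ++ bs (predC C)).
  by rewrite -map_cat; apply: perm_map; rewrite perm_sym; exact/permPl/perm_filterC.
have cl := perm_closed_net pbs (diagram_net_closed d).
have [||E1 [E2 [bs1 [bs2 [cl1 cl2 lab1 lab2 nv]]]]] :=
    split_net (P := fun e => C (tag e)) cl.
- apply/allP => x /mapP[b]; rewrite mem_filter => /andP[Cb _] ->.
  have := diagram_edges b adjC; rewrite Cb.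
  by rewrite -!(eq_all (fun e => eqb_id (C (tag e)))).
- apply/allP => x /mapP[b]; rewrite mem_filter => /andP[/= /negbTE Cb _] ->.
  have := diagram_edges b adjC; rewrite Cb.
  by rewrite !(eq_all (fun e => eqbF_neg (C (tag e)))).
have none_free (Q : pred _) E' (bs' : seq (box r E')) : map fst bs' = map fst (bs Q) ->
    all (fun x => x.1 != None) bs'.
  move=> h; rewrite -[all _ _](all_map fst (fun l => l != None)) h all_map all_map.
  by apply/allP => b _ /=; exact: (forallP idf).
have [d1 [n1 nv1 idf1]] := closed_net_diagram K cl1.
have [d2 [n2 nv2 idf2]] := closed_net_diagram K cl2.
have sizeC (Q : pred 'I_(nboxes d)) b : ~~ Q b -> (size (bs Q) < nboxes d)%N.
  move=> nQb; rewrite size_map size_filter -[X in (_ < X)%N]size_enum_ord.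
  rewrite -(count_predC Q) -[X in (X < _)%N]addn0 ltn_add2l -has_count.
  by apply/hasP; exists b; rewrite ?mem_enum.
exists d1, d2; split.
- apply: inv_of_net_mul => w; rewrite (perm_net_value w pbs) nv1 nv2; exact: nv.
- by split; [apply: idf1 | apply: idf2]; apply: none_free; eauto.
- rewrite n1 n2 (size_labels lab1) (size_labels lab2); split; first exact: sizeC C1.
  by apply: (sizeC _ b0); rewrite /= C0.
Qed.

Lemma connected_decomposition (d : diagram ty) : id_free d ->
  exists2 ds : seq (diagram ty), all (fun c => id_free c && connected_diagram c) ds
    & inv d = \big[@mmul _/@mone _]_(c <- ds) inv c.
Proof.
have [n] := ubnP (nboxes d); elim: n d => // n IH d; rewrite ltnS => size_d idf.
have [n0|n_gt0] := posnP (nboxes d).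
  exists [::] => //; rewrite big_nil; apply/inv_ofP => A.
  by rewrite value_empty value_no_box.
have [conn|nconn] := boolP (connected_diagram d).
  by exists [:: d]; rewrite /= ?idf ?conn // big_seq1.
have [d1 [d2 [-> [idf1 idf2] [lt1 lt2]]]] := split_disconnected n_gt0 nconn idf.
have [|ds1 all1 ->] := IH d1 _ idf1; first exact: leq_trans lt1 _.
have [|ds2 all2 ->] := IH d2 _ idf2; first exact: leq_trans lt2 _.
by exists (ds1 ++ ds2); rewrite ?all_cat ?all1 // big_cat.
Qed.

Lemma loop_decomposition (d : diagram ty) :
  exists k (d' : diagram ty), id_free d' /\
    inv d = mmul (inv d') (\big[@mmul _/@mone _]_(i < k) inv (loop_diagram ty)).
Proof.
have [k [d' [idf nv]]] := remove_identities (leqnn _) (diagram_net_closed d).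
exists k, d'; split=> //.
(* A single diagram representing the power of [D], as [inv_of_net_mul] compares diagrams. *)
have [dk inv_dk val_dk] : exists2 dk : diagram ty,
    inv dk = \big[@mmul _/@mone _]_(i < k) inv (loop_diagram ty)
    & forall w : weights K r, net_value w (diagram_net dk) = #|index_type w|%:R ^+ k.
  elim: (k) => [|m [dm inv_dm val_dm]].
    exists (empty_diagram ty) => [|w]; first by rewrite big_ord0.
    by rewrite -value_weights_structure value_empty.
  exists (juxtapose (loop_diagram ty) dm) => [|w].
    by rewrite big_ord_recl -inv_dm [LHS](inv_of_juxtapose K).
  rewrite -value_weights_structure value_juxtapose !value_weights_structure.
  by rewrite loop_diagram_value val_dm exprS.
by rewrite -inv_dk; apply: inv_of_net_mul => w; rewrite nv val_dk mulrC.
Qed.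

End Decomposition.

(** * Additivity and unique factorization *)

Section Additivity.
Variables (K : fieldType) (r : nat) (ty : 'I_r -> nat * nat).

(* The tensors of [w] extended by zero along a partial inverse [k] of an injection
   of its index type. *)
Definition part (w : weights K r) (J : eqType) (k : J -> option (index_type w))
    (l : box_label r) (s t : seq J) : K :=
  if all (isSome \o k) s && all (isSome \o k) t
  then weight l (pmap k s) (pmap k t) else 0.

(** The direct sum: entries at mixed index sequences vanish, and for a tensor of type [(0,0)] the
    two scalars are added. *)
Definition weights_add (w1 w2 : weights K r) : weights K r :=
  Weights (fun i (s t : seq (index_type w1 + index_type w2)) =>
    @part w1 _ (fun x => if x is inl y then Some y else None) (Some i) s t +
    @part w2 _ (fun x => if x is inr y then Some y else None) (Some i) s t).

Lemma big_supp_image (A B : finType) (h : A -> B) (F : B -> K) : injective h ->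
  (forall b, b \notin codom h -> F b = 0) -> \sum_b F b = \sum_a F (h a).
Proof.
move=> inj F0; rewrite (bigID [in [set h a | a in A]]) /= addrC big1 ?add0r; last first.
  move=> b nb; apply: F0; apply: contra nb => /codomP[a ->]; exact: imset_f.
by rewrite big_imset //=; exact: in2W.
Qed.

(** Every name is an input of some box, so a nonzero product forces all colours into the image of
    [h]; such colourings come from colourings by [index_type w]. *)
Lemma sum_part (d : diagram ty) (w : weights K r) (J : finType)
    (h : index_type w -> J) (k : J -> option (index_type w)) :
  pcancel h k -> ocancel k h ->
  \sum_(f : {ffun strings (in_arity ty) (label d) -> J})
    \prod_(x <- diagram_net d) @part w J k x.1 (map f (outs x)) (map f (ins x))
  = net_value w (diagram_net d).
Proof.
move=> hk kh; pose H (g : {ffun strings (in_arity ty) (label d) -> index_type w}) :=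
  [ffun e => h (g e)].
rewrite (@big_supp_image _ _ H).
- apply: eq_bigr => g _; apply: eq_bigr => x _; rewrite /part.
  have mapE s : map (H g) s = map h (map g s).
    by rewrite -map_comp; apply: eq_map => e; rewrite ffunE.
  have allE s : all (isSome \o k) (map h s).
    by rewrite all_map; apply/allP => e _ /=; rewrite hk.
  have pmapE s : pmap k (map h s) = s by rewrite map_pK.
  by rewrite !mapE !allE !pmapE.
- by move=> g g' /ffunP eg; apply/ffunP => e; have := eg e; rewrite !ffunE => /(pcan_inj hk).
move=> f; apply: contraNeq; rewrite prodf_seq_neq0 => /allP nz.
have nk e : k (f e) != None.
  have e_in : e \in ins (diagram_box (tag e)).
    by case: e => b j; apply: map_f; rewrite mem_enum.
  have := nz (diagram_box (tag e)) (map_f _ (mem_enum _ _)); rewrite /part /=.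
  case: ifP => [/andP[_]|_]; last by rewrite eqxx.
  rewrite all_map => /allP/(_ e e_in) /=; by case: (k (f e)).
have ex e : {y | f e = h y}.
  by have := nk e; case E : (k (f e)) => [y|] // _; exists y; have := kh (f e); rewrite E.
apply/codomP; exists [ffun e => sval (ex e)]; apply/ffunP => e.
by rewrite !ffunE; exact: svalP (ex e).
Qed.

(** The product expands over subsets [J] of [B], with [P] on [J] and [Q] outside. If [J] is neither
    empty nor full, connectedness gives related [c] in [J] and [c'] outside, and [P c * Q c'] kills
    the term. *)
Lemma prod_add_connected (B : finType) (R : rel B) (P Q : B -> K) :
  (0 < #|B|)%N -> symmetric R -> (forall b b', connect R b b') ->
  (forall b b', R b b' -> P b * Q b' = 0) ->
  \prod_b (P b + Q b) = \prod_b P b + \prod_b Q b.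
Proof.
move=> /card_gt0P[b0 _] R_sym conn PQ0; rewrite bigA_distr.
have neq : set0 != [set: B] by apply/eqP/setP => /(_ b0); rewrite !inE.
rewrite (bigD1 setT) //= (bigD1 set0) //= [X in _ + (_ + X)]big1 ?addr0; last first.
  move=> J /andP[JT J0].
  have [b bJ] : exists b, b \in J by apply/set0Pn.
  have [b' b'J] : exists b', b' \notin J.
    by apply/existsP; rewrite -negb_forall; apply: contra JT => /forallP h;
       apply/eqP/setP => x; rewrite inE h.
  have /existsP[c /existsP[c' /and3P[cJ c'J Rcc']]] :
      [exists c, exists c', [&& c \in J, c' \notin J & R c c']].
    apply: contraT; rewrite negb_exists => /forallP h.
    have cl : closed R (mem J).
      apply: (intro_closed (sym_connect_sym R_sym)) => x y Rxy xJ.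
      have := h x; rewrite negb_exists => /forallP/(_ y).
      by rewrite Rxy [x \in J]xJ andbT /= negbK.
    by have := closed_connect cl (conn b b'); rewrite bJ (negbTE b'J).
  have c'c : c' != c by apply: contra c'J => /eqP ->.
  by rewrite (bigD1 c) //= (bigD1 c') //= cJ (negbTE c'J) mulrA PQ0 // mul0r.
by congr (_ + _); apply: eq_bigr => b _; rewrite inE.
Qed.

(** For a fixed colouring, the weight of each box is the sum of its two parts. Adjacent boxes share
    a name, whose colour lies in one summand only, so [prod_add_connected] applies. *)
Lemma connected_value_add (w1 w2 : weights K r) (d : diagram ty) :
  connected_diagram d ->
  net_value (weights_add w1 w2) (diagram_net d)
  = net_value w1 (diagram_net d) + net_value w2 (diagram_net d).
Proof.
case/andP=> d_gt0 /forallP conn.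
pose J : finType := (index_type w1 + index_type w2)%type.
pose k1 (x : J) := if x is inl y then Some y else None.
pose k2 (x : J) := if x is inr y then Some y else None.
rewrite -(@sum_part d w1 J inl k1) //; last by case.
rewrite -(@sum_part d w2 J inr k2) //; last by case.
rewrite -big_split; apply: eq_bigr => f _ /=.
rewrite !(big_map (@diagram_box _ _ d)) !big_enum /=.
rewrite -(@prod_add_connected _ (fun c c' : 'I_(nboxes d) => adjacent c c' || adjacent c' c)).
(* For a label [Some i] this is the definition of [weights_add]; for an identity box, the Kronecker
   symbol of a disjoint union is the sum of the two parts. *)
- apply: eq_bigr => b _ /=; have [wt _ _] := diagram_net_closed d.
  have /andP[] := allP wt _ (map_f (@diagram_box _ _ d) (mem_enum _ b)).
  rewrite -[label d b]/(diagram_box b).1; case: (diagram_box b) => -[i|] [o i'] //.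
  rewrite /outs /ins /=; case: o => [|e [|? ?]] //=; case: i' => [|e' [|? ?]] //= _ _.
  rewrite /part /=; case: (f e) => x; case: (f e') => y;
    by rewrite /= ?add0r ?addr0 //= !eqseq_cons ?andbT.
- by rewrite card_ord.
- by move=> x y; rewrite orbC.
- by move=> b b'; exact: (forallP (conn b)).
move=> b b' bb'; rewrite /part.
case: ifP => [/andP[o1 i1]|_]; last by rewrite mul0r.
case: ifP => [/andP[o2 i2]|_]; last by rewrite mulr0.
(* If both parts were nonzero, the colour of the shared name [connection s] would lie in both
   summands. *)
have contra e : k1 (f e) -> k2 (f e) -> False by case: (f e).
have in_out (s : strings (out_arity ty) (label d)) :
    connection s \in outs (diagram_box (tag s)).
  by case: s => c j; apply: map_f; rewrite mem_enum.
have in_in (e : strings (in_arity ty) (label d)) : e \in ins (diagram_box (tag e)).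
  by case: e => c j; apply: map_f; rewrite mem_enum.
exfalso; case/orP: bb' => /existsP[s /andP[/eqP cE /eqP c'E]];
  have := in_in (connection s); have := in_out s; rewrite cE c'E => eo ei;
  apply: (contra (connection s)).
- exact: (allP o1 _ (map_f f eo)).
- exact: (allP i2 _ (map_f f ei)).
- exact: (allP i1 _ (map_f f ei)).
exact: (allP o2 _ (map_f f eo)).
Qed.

End Additivity.

(** * Separation of connected invariants by their values *)

Section Separation.
Variables (K : fieldType) (r : nat) (ty : 'I_r -> nat * nat).
Local Notation inv := (inv_of K).

Definition inv_value (w : weights K r) (m : Defs.invariant K ty) : K :=
  net_value w (diagram_net (repr m)).

Lemma inv_value_of w (d : diagram ty) : inv_value w (inv d) = net_value w (diagram_net d).
Proof.
have /inv_ofP : inv (repr (inv d)) = inv d by rewrite inv_ofK.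
by rewrite /inv_value -!value_weights_structure.
Qed.

Lemma inv_value1 w : inv_value w mone = 1.
Proof. by rewrite inv_value_of -value_weights_structure value_empty. Qed.

Lemma inv_valueM w m1 m2 : inv_value w (mmul m1 m2) = inv_value w m1 * inv_value w m2.
Proof.
rewrite -[in LHS](inv_ofK m1) -[in LHS](inv_ofK m2).
rewrite -[mmul _ _](inv_of_juxtapose K) inv_value_of.
by rewrite -value_weights_structure value_juxtapose !value_weights_structure.
Qed.

Lemma inv_value_prod w (s : seq (Defs.invariant K ty)) :
  inv_value w (\big[@mmul _/@mone _]_(m <- s) m) = \prod_(m <- s) inv_value w m.
Proof. exact: (big_morph _ (inv_valueM w) (inv_value1 w)). Qed.

Lemma inv_value_inj m1 m2 : (forall w, inv_value w m1 = inv_value w m2) -> m1 = m2.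
Proof.
move=> h; rewrite -[m1]inv_ofK -[m2]inv_ofK; apply/inv_ofP => A.
by rewrite !value_net; exact: h.
Qed.

Lemma inv_value_add w1 w2 (m : Defs.invariant K ty) : connected m ->
  inv_value (weights_add w1 w2) m = inv_value w1 m + inv_value w2 m.
Proof. by move=> /asboolP[d [conn ->]]; rewrite !inv_value_of connected_value_add. Qed.

Lemma inv_value_addn w1 w2 n (m : Defs.invariant K ty) : connected m ->
  inv_value (iter n (fun w => weights_add w w2) w1) m = inv_value w1 m + inv_value w2 m *+ n.
Proof.
move=> conn; elim: n => [|n IH]; first by rewrite addr0.
by rewrite iterS inv_value_add // IH mulrSr addrA.
Qed.

Definition unit_weights : weights K r := Weights (fun _ (_ _ : seq unit) => 1).

Lemma inv_value_unit m : inv_value unit_weights m = 1.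
Proof.
rewrite /inv_value /net_value (eq_bigr (fun=> 1)); last first.
  move=> f _; rewrite big_seq big1 // => x; have [/allP wt _ _] := diagram_net_closed (repr m).
  move=> /wt /andP[]; rewrite /weight; case: x.1 => //= /eqP so /eqP si.
  case: (outs x) so => [|e []] // _; by case: (ins x) si => [|e' []].
by rewrite sumr_const card_ffun card_unit exp1n.
Qed.

Hypothesis charK : [pchar K] =i pred0.

Lemma natr_injective : injective (fun n => n%:R : K).
Proof.
have natr0 := (@pcharf0P K).1 charK.
suff main m n : (m <= n)%N -> m%:R = n%:R :> K -> m = n.
  by move=> m n e; case/orP: (leq_total m n) => le; [|symmetry]; exact: main.
by move=> le e; apply/eqP; rewrite eqn_leq le -subn_eq0 -natr0 natrB // e subrr eqxx.
Qed.

(** The first [size p] natural numbers stay distinct in characteristic zero, and they are too many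
    to be all roots of [p]. *)
Lemma poly_natr_neq0 (p : {poly K}) : p != 0 -> exists n : nat, p.[n%:R] != 0.
Proof.
move=> p0; apply: contrapT => /forallNP h.
pose rs := [seq n%:R : K | n <- iota 0 (size p)].
have := @max_poly_roots _ p rs p0; rewrite size_map size_iota ltnn => /(_ _ _)/notF; apply.
  by apply/allP => x /mapP[n _ ->]; rewrite rootE; apply: contraT => /h.
by rewrite map_inj_uniq ?iota_uniq //; exact: natr_injective.
Qed.

(** Induction on [L]: [w] separates the old pairs, [u] the new one, and the sum of [u] and [n]
    copies of [w] separates them all for a suitable [n]. *)
Lemma separating_weights (L : seq (Defs.invariant K ty * Defs.invariant K ty)) :
  all (fun p => [&& connected p.1, connected p.2 & p.1 != p.2]) L ->
  exists w, all (fun p => inv_value w p.1 != inv_value w p.2) L.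
Proof.
elim: L => [|p L IH] /=; first by exists unit_weights.
case/andP=> /and3P[c1 c2 neq] allL; have [w sepL] := IH allL.
have [u sepu] : exists u, inv_value u p.1 != inv_value u p.2.
  apply: contrapT => /forallNP h; case/eqP: neq; apply: inv_value_inj => u.
  by apply/eqP; apply: contraT => /h.
pose c v (q : Defs.invariant K ty * Defs.invariant K ty) := inv_value v q.1 - inv_value v q.2.
pose f q := (c u q)%:P + (c w q) *: 'X.
(* The value of [f q] at [n] is the difference of the two values of [q] on that sum. The constant
   coefficient is nonzero for [p], the linear one for the pairs in [L]. *)
have [|n nz] := @poly_natr_neq0 (\prod_(q <- p :: L) f q).
  rewrite prodf_seq_neq0; apply/allP => q; rewrite inE => /orP[/eqP ->|qL];
    apply: contraTneq isT => /polyP e.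
    by have := e 0%N; rewrite coefD coefC coefZ coefX mulr0 addr0 coef0 => /eqP;
      rewrite subr_eq0 (negbTE sepu).
  have := e 1%N; rewrite coefD coefC coefZ coefX mulr1 add0r coef0 => /eqP.
  by rewrite subr_eq0 (negbTE (allP sepL q qL)).
exists (iter n (fun v => weights_add v w) u); rewrite -[_ && _]/(all _ (p :: L)).
have allpL : all (fun p => [&& connected p.1, connected p.2 & p.1 != p.2]) (p :: L).
  by rewrite /= c1 c2 neq.
apply/allP => q qL; have /and3P[q1 q2 _] := allP allpL q qL.
rewrite !inv_value_addn // -subr_eq0.
move: nz; rewrite horner_prod prodf_seq_neq0 => /allP/(_ q qL).
rewrite /f !hornerE; apply: contraNneq => <-; rewrite /c.
by rewrite mulrBl !mulr_natr opprD addrACA.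
Qed.

Lemma connected_prod_inj (s t : seq (Defs.invariant K ty)) :
  all (@connected K r ty) s -> all (@connected K r ty) t ->
  \big[@mmul _/@mone _]_(m <- s) m = \big[@mmul _/@mone _]_(m <- t) m -> perm_eq s t.
Proof.
move=> cs ct e; pose S := s ++ t.
have cS : all (@connected K r ty) S by rewrite all_cat cs.
have [|w sepw] := separating_weights (L := [seq p <- allpairs pair S S | p.1 != p.2]).
  apply/allP => p; rewrite mem_filter => /andP[-> /allpairsP[[a b] [aS bS ->]]].
  by rewrite (allP cS) // (allP cS).
have sep a b : a \in S -> b \in S -> inv_value w a = inv_value w b -> a = b.
  move=> aS bS eab; apply: contrapT => /eqP neq.
  have := allP sepw (a, b); rewrite mem_filter /= neq eab eqxx => /(_ _)/notF; apply.
  by apply/allpairsP; exists (a, b).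
(* With this sign, ['X - (g m)%:P] takes at [n] the value of [m] on the sum of [w] and [n] unit
   structures. *)
pose g m := - inv_value w m.
have polyE : \prod_(z <- map g s) ('X - z%:P) = \prod_(z <- map g t) ('X - z%:P).
  apply/eqP; rewrite -subr_eq0; apply: contraT => /poly_natr_neq0[n].
  rewrite hornerD hornerN !horner_prod !big_map.
  have ev s' : all (@connected K r ty) s' -> \prod_(m <- s') ('X - (g m)%:P).[n%:R]
     = inv_value (iter n (fun v => weights_add v unit_weights) w)
         (\big[@mmul _/@mone _]_(m <- s') m).
    move=> cs'; rewrite inv_value_prod; apply: eq_big_seq => m /(allP cs') cm.
    by rewrite inv_value_addn // inv_value_unit hornerXsubC opprK addrC.
  by rewrite !ev // e subrr eqxx.
have /permP pst : perm_eq (map g s) (map g t) by exact: prod_XsubC_eq polyE.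
(* As [w] separates the members of [S], multiplicities of values are multiplicities of
   invariants. *)
apply/allP => x xS /=; have := pst (pred1 (g x)); rewrite !count_map => pc.
have ginj y : y \in S -> preim g (pred1 (g x)) y = pred1 x y.
  by move=> yS /=; rewrite eqr_opp; apply/eqP/eqP => [/sep|->] //; exact.
apply/eqP; rewrite -(@eq_in_count _ (preim g (pred1 (g x)))) => [|y ys]; last first.
  by apply: ginj; rewrite mem_cat ys.
rewrite pc; apply: eq_in_count => y yt.
by apply: ginj; rewrite mem_cat yt orbT.
Qed.

End Separation.

(** * The monoid of invariants *)

Local Notation mprod s f := (\big[@mmul _/@mone _]_(x <- s) f x).

Section Monomials.
Variable V : choiceType.

Definition cm_of (s : seq V) : {cmonom V} := mprod s (@ucm V).

Definition seq_of (c : {cmonom V}) : seq V :=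
  flatten [seq nseq (c v) v | v <- finsupp (cmonom_val c)].

Lemma cm_of_count s v : cm_of s v = count_mem v s.
Proof.
rewrite /cm_of; elim: s => [|x s IH]; first by rewrite big_nil onecmE.
by rewrite big_cons mulcmE ucmE IH.
Qed.

Lemma seq_ofK : cancel seq_of cm_of.
Proof.
move=> c; apply/eqP/cmP => v; rewrite cm_of_count /seq_of count_flatten -map_comp sumnE big_map.
rewrite (eq_bigr (fun x => (x == v) * c x)%N); last by move=> x _; rewrite /= count_nseq.
have [vc|vc] := boolP (v \in finsupp (cmonom_val c)).
  rewrite (bigD1_seq v) ?fset_uniq //= eqxx mul1n big1 ?addn0 // => x /negbTE ->.
  by rewrite mul0n.
rewrite big_seq big1; last first.
  by move=> x xc; case: eqP xc vc => [->->|] //; rewrite mul0n.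
by symmetry; apply: fsfun_dflt.
Qed.

Lemma cm_of_eq s t : cm_of s = cm_of t <-> perm_eq s t.
Proof.
split=> [e|/permP p].
  by apply/allP => v _ /=; rewrite -!cm_of_count e.
by apply/eqP/cmP => v; rewrite !cm_of_count p.
Qed.

Lemma cm_of_cat s t : cm_of (s ++ t) = mmul (cm_of s) (cm_of t).
Proof. by rewrite /cm_of big_cat. Qed.

Variables (M : conomType) (f : V -> M).

(** The monoid morphism extending [f] to the free commutative monoid on [V]. *)
Definition cm_eval (c : {cmonom V}) : M := mprod (seq_of c) f.

Lemma cm_eval_of s : cm_eval (cm_of s) = mprod s f.
Proof. by apply: perm_big; apply/cm_of_eq; rewrite seq_ofK. Qed.

Lemma cm_eval1 : cm_eval mone = mone.
Proof. by rewrite -[in LHS](_ : cm_of [::] = mone) ?cm_eval_of ?big_nil // /cm_of big_nil. Qed.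

Lemma cm_evalM c c' : cm_eval (mmul c c') = mmul (cm_eval c) (cm_eval c').
Proof.
by rewrite -[c]seq_ofK -[c']seq_ofK -cm_of_cat !cm_eval_of big_cat.
Qed.

Lemma cm_evalU v : cm_eval (ucm v) = f v.
Proof.
by rewrite -[ucm v](_ : cm_of [:: v] = _) ?cm_eval_of ?big_seq1 // /cm_of big_seq1.
Qed.

End Monomials.

(** * Unique factorization of invariants *)

Section Invariants.
Variables (K : fieldType) (r : nat) (ty : 'I_r -> nat * nat).
Hypothesis charK : [pchar K] =i pred0.
Local Notation inv := (inv_of K).
Local Notation invt := (Defs.invariant K ty).
Local Notation V := (KX_variables K ty).
Local Notation D := (inv (loop_diagram ty)).

Lemma connected_loop : connected D.
Proof.
apply/asboolP; exists (loop_diagram ty); split=> //.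
by apply/forallP => b; apply/forallP => b'; rewrite (ord1 b) (ord1 b') connect0.
Qed.

(** With all entries zero, [D] still has the dimension as its value. A diagram without identity
    boxes has value 1 if empty, which fails in dimension 0, and value 0 otherwise, which fails in
    dimension 1. *)
Lemma loop_augmented : ~~ unaugmented D.
Proof.
apply/negP => /asboolP[d [idf eD]].
have val_eq (w : weights K r) :
      net_value w (diagram_net (loop_diagram ty)) = net_value w (diagram_net d).
  rewrite -!value_weights_structure; move/inv_ofP: eD. exact.
have [d0|d_gt0] := posnP (nboxes d).
  have := val_eq (Weights (index_type := 'I_0) (fun _ _ _ => 0)).
  rewrite loop_diagram_value card_ord -value_weights_structure value_no_box //.
  by move/eqP; rewrite eq_sym oner_eq0.
have := val_eq (Weights (index_type := 'I_1) (fun _ _ _ => 0)).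
rewrite loop_diagram_value card_ord [RHS]big1 => [/eqP|f _]; first by rewrite oner_eq0.
rewrite big_map big_enum (bigD1 (Ordinal d_gt0)) //=.
by move/forallP/(_ (Ordinal d_gt0)): idf; case: (label d _) => //= i _; rewrite mul0r.
Qed.

Lemma unaugmented_prod (m : invt) : unaugmented m -> exists s : seq V, m = mprod s val.
Proof.
move=> /asboolP[d [idf ->]]; have [ds + ->] := connected_decomposition K idf.
elim: ds => [|c ds IH] /=; first by exists [::]; rewrite !big_nil.
case/andP=> /andP[cidf cconn] /IH[s e].
have cV : unaugmented (inv c) && connected (inv c).
  by apply/andP; split; apply/asboolP; exists c.
by exists (exist _ (inv c) cV :: s); rewrite !big_cons e.
Qed.

Lemma prod_unaugmented (s : seq V) : unaugmented (mprod s val : invt).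
Proof.
elim: s => [|v s IH]; first by rewrite big_nil unaugmented1.
by rewrite big_cons; apply: unaugmentedM => //; case/andP: (valP v).
Qed.

Lemma prod_loop_inj (s t : seq V) k l :
  mmul (mprod s val) (mprod (nseq k D) id) = mmul (mprod t val) (mprod (nseq l D) id) ->
  perm_eq s t /\ k = l.
Proof.
have allV (u : seq V) n : all (@connected K r ty) (map val u ++ nseq n D).
  rewrite all_cat all_nseq connected_loop orbT andbT; apply/allP => m /mapP[v _ ->].
  by case/andP: (valP v).
have prodE (u : seq V) n :
    mprod (map val u ++ nseq n D) id = mmul (mprod u val) (mprod (nseq n D) id).
  by rewrite big_cat big_map.
rewrite -!prodE => /(connected_prod_inj charK (allV _ _) (allV _ _)) p.
(* No unaugmented factor equals [D], so the exponent is the multiplicity of [D]. *)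
have countD (u : seq V) n : count_mem D (map val u ++ nseq n D) = n.
  rewrite count_cat count_nseq /= eqxx mul1n (count_memPn _) //.
  by apply/mapP => -[v _ e]; have := loop_augmented; rewrite e; case/andP: (valP v) => ->.
have kl : k = l by rewrite -(countD s k) (permP p) countD.
by split=> //; move: p; rewrite kl perm_cat2r => /(perm_map_inj val_inj).
Qed.

Lemma loop_factorization (m : invt) :
  exists u k, unaugmented u /\ m = mmul u (mprod (nseq k D) id).
Proof.
rewrite -[m]inv_ofK; have [k [d [idf ->]]] := loop_decomposition K (repr m).
exists (inv d), k; split; first by apply/asboolP; exists d.
by congr mmul; rewrite -[nseq k D]/(ncons k _ [::]) big_const_ord; elim: k => [|k IH];
  rewrite ?big_nil //= big_cons IH.
Qed.

(** With [loop_factorization], the monoid of invariants is the product of the unaugmented ones and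
    the powers of [D]. *)
Lemma loop_factorization_inj (u u' : invt) k k' : unaugmented u -> unaugmented u' ->
  mmul u (mprod (nseq k D) id) = mmul u' (mprod (nseq k' D) id) -> u = u' /\ k = k'.
Proof.
move=> /unaugmented_prod[s ->] /unaugmented_prod[t ->] /prod_loop_inj[p ->].
by split=> //; apply: perm_big.
Qed.

End Invariants.

(** * The algebras *)

Section LinearLift.
Variables (K : fieldType) (M : choiceType) (E : lmodType K) (h : M -> E).

Definition malg_lin (g : {malg K[M]}) : E := \sum_(k <- msupp g) g@_k *: h k.

(** A larger index set is allowed, so that sums for several elements can run over a common one. *)
Lemma malg_linEw (d : {fset M}) g : (msupp g `<=` d)%fset ->
  malg_lin g = \sum_(k <- d) g@_k *: h k.
Proof.
move=> le; rewrite /malg_lin (big_fset_incl _ le) //= => k _ /mcoeff_outdom ->.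
by rewrite scale0r.
Qed.

Lemma malg_lin_linear : linear malg_lin.
Proof.
move=> c x y; pose d := (msupp x `|` msupp y `|` msupp (c *: x + y))%fset.
rewrite !(@malg_linEw d).
- rewrite scaler_sumr -big_split; apply: eq_bigr => k _.
  by rewrite mcoeffD mcoeffZ scalerDl scalerA.
- by rewrite /d -fsetUA fsetUCA fsubsetUl.
- by rewrite /d -fsetUA fsubsetUl.
- by rewrite /d fsubsetUr.
Qed.

HB.instance Definition _ := GRing.isLinear.Build K {malg K[M]} E *:%R malg_lin malg_lin_linear.

Lemma malg_linU k : malg_lin << k >> = h k.
Proof. by rewrite /malg_lin msuppU oner_eq0 big_seq_fset1 mcoeffUU scale1r. Qed.

End LinearLift.

Lemma malg_expand (K : fieldType) (M : choiceType) (g : {malg K[M]}) :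
  g = \sum_(k <- msupp g) g@_k *: << k >>.
Proof.
rewrite {1}[g]monalgE; apply: eq_bigr => k _; apply/malgP => l.
by rewrite mcoeffZ !mcoeffU mulr_natr.
Qed.

Section AlgebraLift.
Variables (K : fieldType) (M : conomType) (A : comAlgType K) (h : M -> A).
Hypotheses (h1 : h mone = 1) (hM : forall m n, h (mmul m n) = h m * h n).

Lemma malg_lin_monoid_morphism : monoid_morphism (malg_lin h).
Proof.
split; first exact: etrans (malg_linU h _) h1.
move=> x y.
rewrite [in LHS](malg_expand x) [in LHS](malg_expand y) mulr_suml linear_sum.
rewrite [in RHS]/(malg_lin h x) mulr_suml; apply: eq_bigr => k _.
rewrite mulr_sumr linear_sum [in RHS]/(malg_lin h y) mulr_sumr; apply: eq_bigr => l _.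
rewrite -scalerAl -scalerAr !linearZ /= -scalerAl -scalerAr; congr (_ *: (_ *: _)).
by rewrite malgM_def fgmulUU mulr1 malg_linU hM.
Qed.

Definition malg_lift : {lrmorphism {malg K[M]} -> A} :=
  HB.pack_for {lrmorphism {malg K[M]} -> A} (malg_lin h)
    (GRing.isMonoidMorphism.Build {malg K[M]} A (malg_lin h) malg_lin_monoid_morphism).

End AlgebraLift.

(** * A criterion for polynomial algebras *)

Section PolynomialAlgebra.
Variables (K : fieldType) (V : choiceType) (N : conomType) (A : comAlgType K).
Variables (f : V -> N) (iota : {linear A -> {malg K[N]}}) (h : {cmonom V} -> A).
Hypotheses (hE : forall c, iota (h c) = << cm_eval f c >>).
Hypothesis iota_inj : injective iota.
Hypotheses (iotaM : {morph iota : a b / a * b}) (iota1 : iota 1 = 1).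
Hypothesis f_inj : injective (cm_eval f).
Hypothesis h_span : forall a : A,
  exists s : seq (K * {cmonom V}), a = \sum_(c <- s) c.1 *: h c.2.

(** The embedding [iota] sends the elements [h c] to distinct basis elements of the monoid algebra
    of [N], so they are independent; they span [A] by [h_span], hence form a basis of monomials. *)
Lemma polynomial_algebra_criterion : is_polynomial_algebra (fun v => h (ucm v)).
Proof.
have h1 : h mone = 1 by apply: iota_inj; rewrite hE iota1 cm_eval1.
have hM m n : h (mmul m n) = h m * h n.
  by apply: iota_inj; rewrite hE iotaM !hE cm_evalM malgM_def fgmulUU mulr1.
exists (malg_lift h1 hM); split; last by move=> v; rewrite /= malg_linU.
have phiE c : malg_lift h1 hM << c >> = h c by rewrite /= malg_linU.
(* Injectivity of [cm_eval f] lets the coefficients of [g] be read off from its image. *)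
have coefE g c : (iota (malg_lift h1 hM g))@_(cm_eval f c) = g@_c.
  rewrite /= /malg_lin linear_sum raddf_sum /= [in RHS](malg_expand g) raddf_sum /=.
  apply: eq_bigr => k _.
  by rewrite linearZ /= hE !mcoeffZ !mcoeffU (inj_eq f_inj).
have inj : injective (malg_lift h1 hM).
  by move=> g g' e; apply/malgP => c; rewrite -!coefE e.
have sur a : {g | malg_lift h1 hM g = a}.
  apply: cid; have [s ->] := h_span a.
  exists (\sum_(c <- s) c.1 *: << c.2 >>).
  by rewrite linear_sum; apply: eq_bigr => c _; rewrite linearZ; congr (_ *: _); exact: phiE.
exists (fun a => sval (sur a)) => x; last exact: svalP (sur x).
by apply: inj; exact: svalP (sur _).
Qed.

End PolynomialAlgebra.

(** * Bases of monomials in the algebras of invariants *)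

Section Algebras.
Variables (K : fieldType) (r : nat) (ty : 'I_r -> nat * nat).
Hypothesis charK : [pchar K] =i pred0.
Local Notation inv := (inv_of K).
Local Notation invt := (Defs.invariant K ty).
Local Notation V := (KX_variables K ty).
Local Notation D := (inv (loop_diagram ty)).

Lemma unaugmented_cm_eval (c : {cmonom V}) : unaugmented (cm_eval val c : invt).
Proof. exact: prod_unaugmented. Qed.

Lemma KX_span (a : KX K ty) :
  exists s : seq (K * {m : invt | unaugmented m}), a = \sum_(c <- s) c.1 *: KX_elt (valP c.2).
Proof.
case: a => a aP; have := aP => /asboolP[s us eqa].
have [s' s'E] : exists s' : seq (K * {m : invt | unaugmented m}),
    s = [seq (c.1, val c.2) | c <- s'].
  elim: s us {eqa} => [|[k m] s IH] /=; first by exists [::].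
  by case/andP=> um /IH[s' ->]; exists ((k, exist _ m um) :: s').
exists s'; apply: val_inj; rewrite linear_sum /= eqa s'E big_map.
by apply: eq_bigr => c _.
Qed.

Lemma KX_polynomial : is_polynomial_algebra (@KX_variable K r ty).
Proof.
pose h (c : {cmonom V}) := KX_elt (unaugmented_cm_eval c).
have -> : @KX_variable K r ty = fun v => h (ucm v).
  by apply: functional_extensionality_dep => v; apply: val_inj; rewrite /= cm_evalU.
apply: (@polynomial_algebra_criterion K V invt (KX K ty) val
  (val : {linear KX K ty -> KXaug K ty}) h) => //.
- exact: val_inj.
(* Unique factorization with exponent 0 of [D] on both sides. *)
- by move=> c c' e; rewrite -[c]seq_ofK -[c']seq_ofK; apply/cm_of_eq;
    have [] := @prod_loop_inj K r ty charK (seq_of c) (seq_of c') 0 0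
      (congr1 (fun m => mmul m _) e).
move=> a; have [s ->] := KX_span a.
elim: s => [|[k [m um]] s [s' IH]]; first by exists [::]; rewrite !big_nil.
have [t mE] := unaugmented_prod um.
exists ((k, cm_of t) :: s'); rewrite big_cons IH [RHS]big_cons.
have -> // : KX_elt (valP (exist (fun m => unaugmented m) m um)) = h (cm_of t).
by apply: val_inj; rewrite /= cm_eval_of mE.
Qed.

Lemma invariant_elt_loops k :
  invariant_elt (mprod (nseq k D) id : invt) = dimension_invariant K ty ^+ k.
Proof.
elim: k => [|k IH]; first by rewrite big_nil.
by rewrite big_cons invariant_eltM IH exprS.
Qed.

Lemma KD_val_exp k : KD_val (KD_D K ty ^+ k) = dimension_invariant K ty ^+ k.
Proof. by elim: k => [|k IH] //; rewrite !exprS -IH. Qed.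

Lemma KD_span (b : KD K ty) : exists p : {poly K}, b = \sum_(i < size p) p`_i *: KD_D K ty ^+ i.
Proof.
case: b => b bP; have := bP => /asboolP[p eqb]; exists p; apply: val_inj.
rewrite linear_sum /= eqb /horner_alg /horner_morph horner_coef size_map_poly.
by apply: eq_bigr => i _; rewrite coef_map mulr_algl -KD_val_exp.
Qed.

Lemma KD_polynomial : is_polynomial_algebra (fun _ : unit => KD_D K ty).
Proof.
have prodE (s : seq unit) : mprod s (fun=> D) = mprod (nseq (size s) D) id.
  by elim: s => [|v s IH]; rewrite ?big_nil //= !big_cons IH.
pose h (c : {cmonom unit}) := KD_D K ty ^+ size (seq_of c).
have hE c : KD_val (h c) = << cm_eval (fun=> D) c >>.
  by rewrite KD_val_exp -invariant_elt_loops -prodE.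
have -> : (fun _ : unit => KD_D K ty) = fun v => h (ucm v).
  by apply: functional_extensionality_dep => v; apply: val_inj; rewrite /= hE cm_evalU.
apply: (@polynomial_algebra_criterion K unit invt (KD K ty) (fun=> D)
  (val : {linear KD K ty -> KXaug K ty}) h) => //.
- exact: val_inj.
- move=> c c'; rewrite /cm_eval !prodE => e.
  have [_ szE] := @prod_loop_inj K r ty charK [::] [::] _ _ (congr1 (mmul (mprod [::] val)) e).
  (* A monomial in one variable is determined by its degree, which is the exponent of [D]. *)
  have unit_nseq (s : seq unit) : s = nseq (size s) tt by elim: s => //= -[] s {1}->.
  by rewrite -[c]seq_ofK -[c']seq_ofK (unit_nseq (seq_of c)) szE -unit_nseq.
move=> b; have [p ->] := KD_span b.
exists [seq (p`_i, cm_of (nseq i tt)) | i <- iota 0 (size p)].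
rewrite big_map -[X in iota 0 X]subn0 -/(index_iota 0 _) big_mkord; apply: eq_bigr => i _ /=.
congr (_ *: _); apply: val_inj; rewrite /= hE cm_eval_of prodE size_nseq.
by rewrite KD_val_exp -invariant_elt_loops.
Qed.

(** Every invariant is uniquely an unaugmented one times a power of [D], so these products form a
    basis of [KXaug], on which a linear map may be prescribed by the values of a bilinear one. *)
Lemma KXaug_tensor_product :
  is_tensor_product (fun (a : KX K ty) (b : KD K ty) => KX_val a * KD_val b).
Proof.
split.
- split=> [b c x y|a c x y].
    by rewrite -[KX_val _]/(c *: KX_val x + KX_val y) mulrDl -scalerAl.
  by rewrite -[KD_val _]/(c *: KD_val x + KD_val y) mulrDr -scalerAr.
- move=> E f.
  have ex (m : invt) : {p : invt * nat | unaugmented p.1 /\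
      m = mmul p.1 (mprod (nseq p.2 D) id)}.
    by apply: cid; have [u [k h]] := loop_factorization m; exists (u, k).
  pose b m := f (KX_elt (proj1 (svalP (ex m)))) (KD_D K ty ^+ (sval (ex m)).2).
  (* Uniqueness of the factorization makes [b] independent of the one chosen by [ex]. *)
  have bE u (um : unaugmented u) k :
      b (mmul u (mprod (nseq k D) id)) = f (KX_elt um) (KD_D K ty ^+ k).
    rewrite /b; case: (ex _) => -[u' k'] /= [um' e].
    have [eu ek] := loop_factorization_inj charK um um' e.
    by subst u' k'; congr (f _ _); apply: val_inj.
  have eltE u (um : unaugmented u) k :
      KX_val (KX_elt um) * KD_val (KD_D K ty ^+ k)
      = << mmul u (mprod (nseq k D) id) >>.
    by rewrite KD_val_exp -invariant_elt_loops -invariant_eltM.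
  have hZ k (x : KXaug K ty) : malg_lin b (k *: x) = k *: malg_lin b x.
    exact: linearZ_LR.
  exists (malg_lin b); split=> [x y|h' h'E g].
    have [s ->] := KX_span x; have [p ->] := KD_span y.
    rewrite linear_sumlz [KX_val _](linear_sum (val : {linear KX K ty -> KXaug K ty})).
    rewrite mulr_suml linear_sum; apply: eq_bigr => c _.
    rewrite linear_sumr [KD_val _](linear_sum (val : {linear KD K ty -> KXaug K ty})).
    rewrite mulr_sumr linear_sum; apply: eq_bigr => i _.
    rewrite linearZl_LR linearZr_LR -(bE _ (valP c.2)) -(malg_linU b).
    rewrite -(eltE _ (valP c.2)) -!hZ.
    by congr (malg_lin b _); rewrite scalerAr scalerAl.
  (* For uniqueness, both maps are compared on the basis of invariants. *)
  rewrite [g]malg_expand !linear_sum; apply: eq_bigr => m _; rewrite !linearZ.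
  congr (_ *: _); rewrite [RHS](malg_linU b m); have [[u k] /= [um ->]] := ex m.
  by rewrite (bE _ um) -h'E eltE.
- exact: (@mulr1 (KXaug K ty) 1).
by move=> a a' c c'; rewrite mulrACA.
Qed.

End Algebras.

Theorem corollary5p9 (K : closedFieldType) (charK : [pchar K] =i pred0)
    (r : nat) (ty : 'I_r -> nat * nat) :
  is_polynomial_algebra (@KX_variable K r ty) /\
  is_polynomial_algebra (fun _ : unit => KD_D K ty) /\
  is_tensor_product (fun (a : KX K ty) (b : KD K ty) => KX_val a * KD_val b).
Proof.
split; first exact: KX_polynomial.
by split; [exact: KD_polynomial | exact: KXaug_tensor_product].
Qed.
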